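(* Let $u$ be the local solution of the surface growth equation $u_t=-u_{xxxx}-(u_x^2)_{xx}$ with initial value $u(0)\in H^1$ and maximal existence time $\tau(u(0))$, let $\varphi$ be an approximation on $[0,T]$, let $d:=u-\varphi$, let $\mathrm{Res}:=\varphi_t+\varphi_{xxxx}+(\varphi_x^2)_{xx}$, and let $K:=7^7/4$. Then for (almost every) $t\in(0,T)$ with $t<\tau(u(0))$, $$\frac12\,\partial_t\|d\|_{H^1}^2\le-\frac14\|d\|_{H^3}^2+K\|d\|_{H^1}^{10}+\|\mathrm{Res}\|_{H^{-1}}^2+9\|d\|_{H^1}^2\|\varphi_{xx}\|_{L^\infty}^2$$ and consequently $$\frac12\,\partial_t\|d\|_{H^1}^2\le K\|d\|_{H^1}^{10}+\Big(9\|\varphi_{xx}\|_{L^\infty}^2-\frac14\Big)\|d\|_{H^1}^2+\|\mathrm{Res}\|_{H^{-1}}^2 .$$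
   Context: All functions are real valued, $2\pi$-periodic in $x\in[0,2\pi]$ and have zero mean, $\int_0^{2\pi}u(x,t)\,dx=0$. For $p\ge1$, $\|u\|_{H^p}:=\|\partial_x^pu\|_{L^2(0,2\pi)}$, and $\|\cdot\|_{H^{-1}}$ is the dual norm, $\|f\|_{H^{-1}}=\sup\{\langle f,v\rangle: \int_0^{2\pi} v\,dx=0,\ \|v\|_{H^1}\le1\}$, with $\langle\cdot,\cdot\rangle$ the $L^2$ pairing. Known local existence theory (may be assumed): for every $u_0\in H^1$ there is a maximal time $\tau(u_0)\in(0,\infty]$ and a unique solution $u\in C^0([0,\tau(u_0)),H^1)$ of the equation with $u(0)=u_0$; it is $C^\infty$ in space and time on $(0,\tau(u_0))\times[0,2\pi]$, and if $\tau(u_0)<\infty$ then $\limsup_{t\to\tau(u_0)}\|u(t)\|_{H^1}=\infty$. An approximation $\varphi=\varphi(x,t)$ on $[0,T]$ is an arbitrary function satisfying the periodic boundary conditions and the zero-mean condition which is $H^4_{\mathrm{per}}$ in space and $H^1$ in time, i.e. $\varphi\in H^1([0,T];H^4_{\mathrm{per}})$. *)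

(* Defs.v *)
From HB Require Import structures.
From mathcomp Require Import all_boot all_order all_algebra.
From mathcomp Require Import all_classical all_reals all_analysis.

Set Implicit Arguments.
Unset Strict Implicit.
Unset Printing Implicit Defensive.

Import Order.TTheory GRing.Theory Num.Theory.
Import numFieldNormedType.Exports.

Local Open Scope ring_scope.
Local Open Scope classical_set_scope.

Section Spaces.
Context {R : realType}.
Implicit Types (f g v : R -> R) (p : nat).

Definition cell : set R := `[0, 2 * pi].

(* L^q(0, 2 pi) norm: the library norm of the extension of f by 0. *)
Definition Lqnorm (q : \bar R) f : R :=
  fine ('N[lebesgue_measure]_q [EFin \o (f \_ cell)])%E.

Definition Hnorm p f : R := Lqnorm 2%:E (derive1n p f).

(* Zero-mean functions in H^p_per, for p >= 1, through their C^(p-1)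
   representative. The integral identity says that f^`(p.-1) is locally
   absolutely continuous; f^`(p) is then its classical derivative, which exists
   almost everywhere and represents the weak derivative. At the exceptional
   points f^`(p) takes the default value of a limit that does not exist, which
   no integral sees. *)
Record Hper p f : Prop := {
  Hper_periodic : forall x, f (x + 2 * pi) = f x ;
  Hper_mean0 : \int[lebesgue_measure]_(x in cell) f x = 0 ;
  Hper_derivable : forall k, (k < p.-1)%N -> forall x : R, derivable (derive1n k f) x 1 ;
  Hper_L2 : (derive1n p f \_ cell) \in Lfun lebesgue_measure 2%:E ;
  Hper_abs_cont : forall a b : R, a <= b ->
    derive1n p.-1 f b - derive1n p.-1 f a =
      \int[lebesgue_measure]_(x in `[a, b]) derive1n p f x
}.

Definition Hm1norm f : R :=
  sup [set r | exists2 v, Hper 1 v /\ Hnorm 1 v <= 1 &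
                 r = \int[lebesgue_measure]_(x in cell) (f x * v x)].

End Spaces.

Section SpaceTime.
Context {R : realType}.
(* Functions of (t, x), in this order, so that u t is the profile at time t. *)
Implicit Types (u w phi : R -> R -> R) (T : R) (tau : \bar R).

Definition dt u : R -> R -> R := fun t x => derive1 (u ^~ x) t.
Definition dx u : R -> R -> R := fun t x => derive1 (u t) x.

(* C^n on the open strip (0, tau) x R: all iterated partial derivatives up to
   order n exist and are jointly continuous. *)
Fixpoint Cn_on (n : nat) tau u : Prop :=
  (forall t x : R, 0 < t -> (t%:E < tau)%E ->
     {for (t, x), continuous (fun z : R * R => u z.1 z.2)}) /\
  if n is m.+1 then
    [/\ forall t x : R, 0 < t -> (t%:E < tau)%E ->
          derivable (u ^~ x) t 1 /\ derivable (u t) x 1,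
        Cn_on m tau (dt u) & Cn_on m tau (dx u)]
  else True.

Definition smooth_on tau u : Prop := forall n, Cn_on n tau u.

Definition growth_op u : R -> R -> R := fun t x =>
  derive1n 4 (u t) x + derive1n 2 (fun y => dx u t y ^+ 2) x.

(* Solutions in C^0([0, tau), H^1). They are smooth for positive times, so the
   equation is meant pointwise there, with x ranging over the whole line by
   periodicity. *)
Record is_solution tau u : Prop := {
  sol_time : (0 < tau)%E ;
  sol_H1 : forall t : R, 0 <= t -> (t%:E < tau)%E -> Hper 1 (u t) ;
  sol_cont : forall t : R, 0 <= t -> (t%:E < tau)%E ->
    Hnorm 1 (u s \- u t)
      @[s --> within [set s : R | 0 <= s /\ (s%:E < tau)%E] (nbhs t)] --> (0 : R) ;
  sol_smooth : smooth_on tau u ;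
  sol_eq : forall t x : R, 0 < t -> (t%:E < tau)%E ->
    dt u t x = - growth_op u t x
}.

(* tau is the maximal existence time for the initial value u 0. *)
Definition is_maximal_solution tau u : Prop :=
  is_solution tau u /\
  forall tau' w, is_solution tau' w -> w 0 = u 0 -> (tau' <= tau)%E.

(* Absolute continuity on [0, T] with values in H^4. *)
Definition H4_abs_cont T phi : Prop :=
  forall e : R, 0 < e -> exists2 delta : R, 0 < delta &
    forall (n : nat) (a b : nat -> R),
      (forall i, (i < n)%N -> [/\ 0 <= a i, a i <= b i & b i <= T]) ->
      (forall i j, (i < j)%N -> (j < n)%N -> b i <= a j) ->
      \sum_(i < n) (b i - a i) < delta ->
      \sum_(i < n) Hnorm 4 (phi (b i) \- phi (a i)) < e.

(* phi in H^1([0, T]; H^4_per), zero mean, through its continuous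
   representative in time: absolutely continuous with values in H^4, with a
   strong derivative almost everywhere that is square integrable. Convergence
   in H^4 of zero-mean functions is uniform, so this derivative is the pointwise
   one. Its H^4 norm is then measurable up to a null set, and the library
   integral of a nonnegative function (a supremum over simple functions below
   it) does not depend on the values on that set. *)
Record is_approximation T phi : Prop := {
  app_H4 : forall t, 0 <= t <= T -> Hper 4 (phi t) ;
  app_abs_cont : H4_abs_cont T phi ;
  app_dt : \forall t \ae lebesgue_measure, 0 < t < T ->
    Hper 4 (dt phi t) /\
    Hnorm 4 (fun x => (phi (t + h) x - phi t x) / h - dt phi t x)
      @[h --> 0^'] --> (0 : R) ;
  app_dt_L2 :
    (\int[lebesgue_measure]_(t in `[0%R, T]) (Hnorm 4 (dt phi t) ^+ 2)%:E < +oo)%E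
}.

Definition Res phi : R -> R -> R := fun t x => dt phi t x + growth_op phi t x.

End SpaceTime.

(* Main.v *)
Require Import Defs.
From mathcomp Require Import all_boot all_order all_algebra.
From mathcomp Require Import all_classical all_reals all_analysis.
From mathcomp Require Import measurable_realfun ess_sup_inf.
From mathcomp Require Import ring lra.
Import Order.TTheory GRing.Theory Num.Theory.
Import numFieldNormedType.Exports.
Local Open Scope ring_scope.
Local Open Scope classical_set_scope.

(** At a fixed time write d1, d2, d3 for the space derivatives of the error d,
P1, P2, P3 for those of phi, and a, Y, b for the L2 norms of d1, d2, d3 over one
period. Subtracting the two equations and testing with - d2 gives

   (1/2) (a^2)' = - b^2 + \int d2^3 + \int P2 d2^2 - 2 \int P2 d1 d3
                  + \int Res d2,

because the remaining nonlinear terms form the derivative of the periodic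
function d1 d2^2 + P1 d2^2 + 2 d1 d2 P2 (energy_estimate). Integration by parts
gives Y^2 <= a b, so the two terms with P2 are at most 3 N a b, where N is the
uniform norm of P2, and duality bounds the last one by the dual norm of Res
times b (Hm1norm_pairing). Since d2 vanishes somewhere, d2^2 <= 2 Y b pointwise
(sup_interpolation), hence the cubic term I satisfies I^8 <= 16 a^10 b^14, and
the inequality of Young leaves b^2 / 4 + K a^10 (cubic_Young). Each of the three
groups costs at most b^2 / 4, so one quarter of the dissipation b^2 survives.
The second inequality follows from a <= b, which is the sharp Wirtinger
inequality on a period of length 2 pi, applied twice.

Two points of regularity remain. The fourth derivative of phi is only square
integrable, so third derivatives are treated as absolutely continuous functions
with a chosen density, for which integration by parts against C^1 functions
holds (ac_prod). The energy is differentiated in time through its increments: by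
parts,

   \int (d1 + del1)^2 - \int d1^2 = - 2 \int d2 del + \int del1^2

for an increment del of the error with space derivative del1 (energy_increment).
It therefore suffices that the difference quotients of d converge uniformly and
that those of d1 stay bounded. For u both follow from the mean value theorem in
time, for phi from convergence in H^4 (weakH4_sup). *)

Set Implicit Arguments.
Unset Strict Implicit.
Unset Printing Implicit Defensive.

(** * Integrals over a segment *)

Section LowerIntegral.
Context d (T : measurableType d) (R : realType)
  (mu : {measure set T -> \bar R}).
Local Open Scope ereal_scope.

Import HBNNSimple.

(** The integral of a nonnegative function is the supremum of the integrals of the
simple functions below it, and no such integral changes when a null set is
discarded; so f may be nonmeasurable. This is the situation of the pointwise
fourth derivative of a linear combination, which is known only almost
everywhere. *)
Lemma ge0_ae_eq_integral_lower (D : set T) (f g : T -> \bar R) :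
  measurable D -> measurable_fun D g ->
  (forall x, D x -> 0 <= f x) -> (forall x, D x -> 0 <= g x) ->
  (\forall x \ae mu, D x -> f x = g x) ->
  \int[mu]_(x in D) f x = \int[mu]_(x in D) g x.
Proof.
move=> mD mg f0 g0 fg; apply/eqP; rewrite eq_le; apply/andP; split.
  rewrite ge0_integralE//; apply: ge_ereal_sup => _ [h /= hf <-].
  have -> : sintegral mu h = \int[mu]_x (h x)%:E.
    rewrite integral_nnsfun//; apply: eq_sintegral => x.
    by rewrite patchE in_setT.
  rewrite (integral_mkcond D); apply: ae_ge0_le_integral => //.
  - by move=> x _; rewrite lee_fin; exact: fun_ge0.
  - exact/measurable_EFinP.
  - by move=> x _; apply: erestrict_ge0.
  - exact/(measurable_restrictT _ _).1.
  apply: filterS fg => x fg _; apply: (le_trans (hf x)); rewrite !patchE.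
  by case: ifPn => // /set_mem /fg ->.
have [N [mN N0 subN]] := fg.
rewrite (ge0_negligible_integral mN)// (integral_mkcond (D `\` N)).
rewrite [leRHS]ge0_integralE// ge0_integralE; last first.
  by move=> x _; rewrite patchE; case: ifPn => // /set_mem[/g0].
apply: ge_ereal_sup => _ [h /= hg <-].
apply: ereal_sup_ubound; exists h => //= x.
have := hg x; rewrite !patchE in_setT.
have [xDN|xDN] := boolP (x \in D `\` N).
  have [Dx Nx] := set_mem xDN.
  rewrite mem_set// => /le_trans; apply.
  have [->//|fgx] := pselect (f x = g x).
  by exfalso; apply/Nx/subN => /= /(_ Dx).
by move=> /le_trans; apply; case: ifPn => // /set_mem /f0.
Qed.

End LowerIntegral.

Section Segment.
Context {R : realType}.
Notation mu := (@lebesgue_measure R).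
Implicit Types (f g F G : R -> R) (a b x y : R).

Lemma segment_FTC F f a b : a <= b ->
  {within `[a, b], continuous f} ->
  (forall x, a <= x <= b -> is_derive x 1 F (f x)) ->
  \int[mu]_(x in `[a, b]) f x = F b - F a.
Proof.
rewrite le_eqVlt => /predU1P[<- _ _|ab cf dF].
  by rewrite set_itv1 Rintegral_set1 subrr.
have cF x : a <= x <= b -> {for x, continuous F}.
  move=> xab; have [dFx _] := dF x xab.
  exact/differentiable_continuous/derivable1_diffP.
have inc x : x \in `]a, b[%R -> a <= x <= b.
  by rewrite in_itv/= => /andP[ax xb]; rewrite !ltW.
rewrite /Rintegral (continuous_FTC2 (F := F) ab cf)//.
  split.
  - by move=> x /inc xab; have [] := dF x xab.
  - by apply/cvg_at_right_filter/cF; rewrite lexx ltW.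
  - by apply/cvg_at_left_filter/cF; rewrite lexx ltW.
by move=> x /inc xab; rewrite derive1E; have [_ ->] := dF x xab.
Qed.

Lemma continuous_segment_integrable f a b :
  {within `[a, b], continuous f} -> mu.-integrable `[a, b] (EFin \o f).
Proof. exact/continuous_compact_integrable/segment_compact. Qed.

Lemma derivable_continuous f : (forall x : R, derivable f x 1) -> continuous f.
Proof. by move=> df x; exact/differentiable_continuous/derivable1_diffP. Qed.

Lemma increment_MVT F f (t h : R) :
  (forall s : R, `|s - t| <= `|h| -> is_derive s 1 F (f s)) ->
  exists2 s, `|s - t| <= `|h| & F (t + h) - F t = f s * h.
Proof.
move=> dF.
have cF a b : (forall s, a <= s <= b -> `|s - t| <= `|h|) ->
    {within `[a, b], continuous F}.
  move=> ab; apply: derivable_within_continuous => s.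
  by rewrite in_itv/= => /ab /dF[].
have [h0|/ltW h0] := leP 0 h.
  have near s : t <= s <= t + h -> `|s - t| <= `|h|.
    move=> /andP[ts sh]; rewrite !ger0_norm ?subr_ge0//.
    by rewrite lerBlDr addrC.
  have tth : t <= t + h by rewrite lerDl.
  have dFs s : s \in `]t, t + h[%R -> is_derive s 1 F (f s).
    by rewrite in_itv/= => /andP[ts sh]; apply/dF/near; rewrite !ltW.
  have [s] := MVT_segment tth dFs (cF _ _ near).
  by rewrite in_itv/= => /near sh ->; exists s => //; congr (_ * _); rewrite addrC addKr.
have near s : t + h <= s <= t -> `|s - t| <= `|h|.
  move=> /andP[ts sh]; rewrite !ler0_norm ?subr_le0//.
  by rewrite lerN2 lerBrDr addrC.
have tth : t + h <= t by rewrite gerDl.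
have dFs s : s \in `]t + h, t[%R -> is_derive s 1 F (f s).
  by rewrite in_itv/= => /andP[ts sh]; apply/dF/near; rewrite !ltW.
have [s] := MVT_segment tth dFs (cF _ _ near).
rewrite in_itv/= => /near sh /eqP; rewrite -eqr_opp opprB => /eqP ->.
by exists s => //; rewrite -mulrN; congr (_ * _); rewrite opprB addrC addKr.
Qed.

End Segment.

Section SegmentIntegral.
Context {R : realType}.
Notation mu := (@lebesgue_measure R).
Implicit Types (f g F G : R -> R) (a b x y : R).

Lemma continuous_segment_bounded f a b : {within `[a, b], continuous f} ->
  exists2 M : R, 0 <= M & forall x, a <= x <= b -> `|f x| <= M.
Proof.
move=> cf.
have /compact_bounded[M [_ Mf]] := continuous_compact cf (@segment_compact R a b).
exists (`|M| + 1); first by rewrite addr_ge0.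
move=> x xab; apply: Mf; last by exists x => //=; rewrite in_itv.
by rewrite (le_lt_trans (ler_norm M))// ltrDl.
Qed.

Lemma segment_measure a b : a <= b -> fine (mu `[a, b]%classic) = b - a.
Proof.
move=> ab; rewrite lebesgue_measure_itv/= lte_fin.
case: ifPn => //=; rewrite -leNgt => ba.
by have /eqP -> : a == b; rewrite ?subrr// eq_le ab.
Qed.

Lemma continuous_segment_measurable f a b : {within `[a, b], continuous f} ->
  measurable_fun `[a, b] f.
Proof. by move=> cf; exact: subspace_continuous_measurable_fun. Qed.

Lemma integrable_mulr_continuous f g a b :
  mu.-integrable `[a, b] (EFin \o f) -> {within `[a, b], continuous g} ->
  mu.-integrable `[a, b] (EFin \o (fun x => f x * g x)).
Proof.
move=> intf cg; have [M M0 gM] := continuous_segment_bounded cg.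
apply: eq_integrable (integrableMl _ intf (continuous_segment_measurable cg) _) => //.
exists M; split; first exact: num_real.
move=> N MN x /=; rewrite in_itv/= => xab.
by rewrite (le_trans (gM x xab))// ltW.
Qed.

Lemma integrable_subsegment f a b c d : a <= c -> d <= b ->
  mu.-integrable `[a, b] (EFin \o f) -> mu.-integrable `[c, d] (EFin \o f).
Proof.
move=> ac db; apply: integrableS => // x /=; rewrite !in_itv/= => /andP[cx xd].
by rewrite (le_trans ac)//= (le_trans xd).
Qed.

Lemma continuous_subsegment f a b c d : a <= c -> d <= b ->
  {within `[a, b], continuous f} -> {within `[c, d], continuous f}.
Proof.
move=> ac db; apply: continuous_subspaceW => x /=; rewrite !in_itv/=.
by move=> /andP[cx xd]; rewrite (le_trans ac)//= (le_trans xd).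
Qed.

Lemma segment_integral_cat f a b c : a <= b -> b <= c ->
  mu.-integrable `[a, c] (EFin \o f) ->
  \int[mu]_(x in `[a, c]) f x =
    \int[mu]_(x in `[a, b]) f x + \int[mu]_(x in `[b, c]) f x.
Proof.
move=> ab bc intf; apply/eqP; rewrite addrC -subr_eq; apply/eqP.
have := @Rintegral_itvB R f (BLeft a) (BRight c) b intf.
rewrite !bnd_simp => -> //; apply: Rintegral_itv_obnd_cbnd.
apply: integrableS intf => // x /=; rewrite !in_itv/= => /andP[bx xc].
by rewrite xc andbT (le_trans ab)// ltW.
Qed.

Lemma segment_integrable_cst c a b : mu.-integrable `[a, b] (EFin \o (fun=> c)).
Proof.
by apply/continuous_segment_integrable/continuous_subspaceT/cst_continuous.
Qed.

Lemma segment_integral_le_cst f a b M : a <= b ->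
  mu.-integrable `[a, b] (EFin \o f) ->
  (forall x, a <= x <= b -> f x <= M) ->
  \int[mu]_(x in `[a, b]) f x <= M * (b - a).
Proof.
move=> ab intf fM; rewrite -(segment_measure ab) -Rintegral_cst//.
apply: le_Rintegral => //.
exact: segment_integrable_cst.
Qed.

Lemma integrable_abs f (D : set R) : mu.-integrable D (EFin \o f) ->
  mu.-integrable D (EFin \o (fun x => `|f x|)).
Proof. exact: integrable_norm. Qed.

Lemma integrable_scale c f (D : set (measurableTypeR R)) : measurable D ->
  mu.-integrable D (EFin \o f) ->
  mu.-integrable D (EFin \o (fun x => c * f x)).
Proof. by move=> mD intf; have := integrableZl mD c intf. Qed.

Lemma integrable_scaler c f (D : set (measurableTypeR R)) : measurable D ->
  mu.-integrable D (EFin \o f) ->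
  mu.-integrable D (EFin \o (fun x => f x * c)).
Proof. by move=> mD intf; have := integrableZr mD c intf. Qed.

Lemma integrable_add f g (D : set (measurableTypeR R)) : measurable D ->
  mu.-integrable D (EFin \o f) -> mu.-integrable D (EFin \o g) ->
  mu.-integrable D (EFin \o (fun x => f x + g x)).
Proof. by move=> mD intf intg; have := integrableD mD intf intg. Qed.

Lemma integrable_sub f g (D : set (measurableTypeR R)) : measurable D ->
  mu.-integrable D (EFin \o f) -> mu.-integrable D (EFin \o g) ->
  mu.-integrable D (EFin \o (fun x => f x - g x)).
Proof. by move=> mD intf intg; have := integrableB mD intf intg. Qed.

End SegmentIntegral.

(** * Absolutely continuous functions on the cell *)

Lemma measurable_cell {R : realType} :
  measurable (cell : set (measurableTypeR R)).
Proof. exact: measurable_itv. Qed.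
#[local] Hint Resolve measurable_cell : core.

Section AbsolutelyContinuous.
Context {R : realType}.
Notation mu := (@lebesgue_measure R).
Implicit Types (f g F G : R -> R) (a b x y : R).

(** The density is a parameter because derivatives of the highest order are known
only through one of their representatives. *)
Definition ac F f : Prop := mu.-integrable cell (EFin \o f) /\
  forall a b, 0 <= a -> a <= b -> b <= 2 * pi ->
    F b - F a = \int[mu]_(x in `[a, b]) f x.

Lemma pi2_ge0 : 0 <= 2 * pi :> R.
Proof. by rewrite mulr_ge0// pi_ge0. Qed.

Lemma ac_C1 F f : {within cell, continuous f} ->
  (forall x, 0 <= x <= 2 * pi -> is_derive x 1 F (f x)) -> ac F f.
Proof.
move=> cf dF; split; first exact: continuous_segment_integrable.
move=> a b a0 ab b2; symmetry; apply: segment_FTC => //.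
  exact: continuous_subsegment cf.
by move=> x /andP[ax xb]; apply: dF; rewrite (le_trans a0)//= (le_trans xb).
Qed.

Lemma ac_lin c F f G g : ac F f -> ac G g ->
  ac (fun x => c * F x + G x) (fun x => c * f x + g x).
Proof.
move=> [intf Ff] [intg Gg].
have intcf : mu.-integrable cell (EFin \o (fun x => c * f x)).
  exact: integrable_scale.
split; first exact: integrable_add.
move=> a b a0 ab b2; rewrite RintegralD//; last 2 first.
- exact: integrable_subsegment intcf.
- exact: integrable_subsegment intg.
rewrite RintegralZl//; last exact: integrable_subsegment intf.
by rewrite -Ff// -Gg//; ring.
Qed.

Lemma ac_osc F f x y : ac F f -> 0 <= x <= 2 * pi -> 0 <= y <= 2 * pi ->
  `|F x - F y| <= \int[mu]_(z in cell) `|f z|.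
Proof.
move=> [intf Ff]; wlog yx : x y / y <= x.
  move=> h hx hy; have [/h|/ltW/h] := leP y x; first exact.
  by rewrite distrC; apply.
move=> /andP[x0 x2] /andP[y0 y2]; rewrite Ff//.
have intn := integrable_abs intf.
rewrite (le_trans (le_normr_Rintegral _ _))//.
  exact: integrable_subsegment intf.
rewrite [leRHS](segment_integral_cat y0)//.
rewrite [X in _ <= _ + X](segment_integral_cat yx x2); last first.
  exact: integrable_subsegment intn.
rewrite addrCA lerDl addr_ge0//; exact: Rintegral_ge0.
Qed.

Lemma ac_continuous F f : ac F f -> {within cell, continuous F}.
Proof.
move=> [intf Ff].
have := parameterized_integral_continuous pi2_ge0 intf.
have h : {in cell, (fun x => parameterized_integral mu 0 x f + F 0) =1 F}.
  move=> x; rewrite inE /cell/= in_itv/= => /andP[x0 x2].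
  by rewrite /parameterized_integral -Ff// subrK.
move=> ci; apply: (subspace_eq_continuous h) => x.
by apply: cvgD; [exact: ci|exact: cvg_cst].
Qed.

(** Cut the segment from 0 to L into n equal pieces. The increments of A telescope,
so the increment of H is at most C L (A L - A 0) / n. *)
Lemma quadratic_increment_cst (H A : R -> R) (C L : R) : 0 <= C -> 0 <= L ->
  (forall x y, 0 <= x -> x <= y -> y <= L ->
    `|H y - H x| <= C * (y - x) * (A y - A x)) ->
  H L = H 0.
Proof.
move=> C0 L0 HA.
have step n k : (k <= n.+1)%N ->
    `|H (k%:R * (L / n.+1%:R)) - H 0| <=
      C * (L / n.+1%:R) * (A (k%:R * (L / n.+1%:R)) - A 0).
  set l := L / n.+1%:R.
  have l0 : 0 <= l by rewrite divr_ge0.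
  elim: k => [_|k IH kn]; first by rewrite mul0r !subrr normr0 mulr0.
  have := @HA (k%:R * l) (k.+1%:R * l).
  rewrite mulr_ge0// ler_wpM2r ?ler_nat// => /(_ isT isT).
  have -> : k.+1%:R * l - k%:R * l = l by rewrite -mulrBl -natrB ?subSnn ?mul1r.
  have lL : k.+1%:R * l <= L.
    rewrite /l mulrCA -[leRHS]mulr1 ler_wpM2l// ler_pdivrMr ?mul1r ?ler_nat//.
  move=> /(_ lL) h; have := IH (ltnW kn) => h'.
  rewrite (le_trans (ler_distD (H (k%:R * l)) _ _))//.
  by rewrite (le_trans (lerD h h'))// -mulrDr addrA subrK.
apply/eqP; rewrite -subr_eq0 -normr_eq0; apply/negP => /negP HLn0.
have H0 : 0 < `|H L - H 0| by rewrite lt_def HLn0 normr_ge0.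
have [n nE] : exists n : nat, C * L * (A L - A 0) / `|H L - H 0| < n.+1%:R.
  set X := _ / _; exists (Num.bound `|X|).
  rewrite (le_lt_trans (ler_norm _))// (lt_trans (archi_boundP _))//.
  by rewrite ltr_nat.
have := step n n.+1 (leqnn _).
have -> : n.+1%:R * (L / n.+1%:R) = L by rewrite mulrCA divff ?mulr1// pnatr_eq0.
move: nE; rewrite ltr_pdivrMr// => nE.
rewrite mulrA mulrAC ler_pdivlMr ?ltr0n// mulrC => /le_lt_trans/(_ nE).
by rewrite ltxx.
Qed.

(** Let H x be the difference between the integral over the segment from 0 to x and
F x * G x. Over a segment from x to y the increment of H is the integral of
f (G - G y) + (F - F x) g, which is at most the product of 2 M (y - x) and the
integral of the absolute value of f, where M bounds g. Hence H is constant by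
quadratic_increment_cst. *)
Lemma ac_prod F f G g : ac F f -> {within cell, continuous g} ->
  (forall x, 0 <= x <= 2 * pi -> is_derive x 1 G (g x)) ->
  \int[mu]_(x in cell) (f x * G x + F x * g x) =
    F (2 * pi) * G (2 * pi) - F 0 * G 0.
Proof.
move=> acF cg dG; have acG := ac_C1 cg dG.
have [intf Ff] := acF; have [intg Gg] := acG.
have cF := ac_continuous acF; have cG := ac_continuous acG.
have intn := integrable_abs intf.
have [M M0 gM] := continuous_segment_bounded cg.
pose P x := \int[mu]_(z in `[0, x]) (f z * G z + F z * g z).
pose H x := P x - F x * G x.
have intfG : mu.-integrable cell (EFin \o (fun x => f x * G x)).
  exact: integrable_mulr_continuous.
have intFg : mu.-integrable cell (EFin \o (fun x => F x * g x)).
  apply: continuous_segment_integrable => x.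
  by apply: continuousM; [exact: cF|exact: cg].
have intP : mu.-integrable cell (EFin \o (fun x => f x * G x + F x * g x)).
  exact: integrable_add.
suff : H (2 * pi) = H 0.
  rewrite /H {2}/P set_itv1 Rintegral_set1 sub0r => /eqP.
  by rewrite subr_eq addrC => /eqP.
apply: (@quadratic_increment_cst H (fun x => \int[mu]_(z in `[0, x]) `|f z|) (2 * M)).
- by rewrite mulr_ge0.
- exact: pi2_ge0.
move=> x y x0 xy y2.
have y0 := le_trans x0 xy; have x2 := le_trans xy y2.
have sub (h : R -> R) : mu.-integrable cell (EFin \o h) -> mu.-integrable `[x, y] (EFin \o h).
  exact: integrable_subsegment.
have sub0 (h : R -> R) : mu.-integrable cell (EFin \o h) -> mu.-integrable `[0, y] (EFin \o h).
  exact: integrable_subsegment.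
set W := \int[mu]_(z in `[x, y]) `|f z|.
have W0 : 0 <= W by exact: Rintegral_ge0.
have -> : \int[mu]_(z in `[0, y]) `|f z| - \int[mu]_(z in `[0, x]) `|f z| = W.
  by rewrite (segment_integral_cat x0 xy) ?sub0// addrAC subrr add0r.
have in01 z : x <= z <= y -> 0 <= z <= 2 * pi.
  by move=> /andP[xz zy]; rewrite (le_trans x0)//= (le_trans zy).
have i1 : mu.-integrable `[x, y] (EFin \o (fun z => f z * G y)).
  by apply: integrable_scaler => //; exact: sub.
have i2 : mu.-integrable `[x, y] (EFin \o (fun z => F x * g z)).
  by apply: integrable_scale => //; exact: sub.
have HE : H y - H x = \int[mu]_(z in `[x, y])
    ((f z * G z + F z * g z) - (f z * G y + F x * g z)).
  rewrite RintegralB//; [|exact: sub|exact: (integrable_add _ i1 i2)].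
  rewrite (RintegralD _ i1 i2)//.
  rewrite RintegralZr ?RintegralZl ?sub// -Ff// -Gg//.
  rewrite /H /P (segment_integral_cat x0 xy) ?sub0//; ring.
have intD : mu.-integrable `[x, y] (EFin \o (fun z =>
    (f z * G z + F z * g z) - (f z * G y + F x * g z))).
  by apply: integrable_sub => //; [exact: sub|exact: (integrable_add _ i1 i2)].
rewrite HE (le_trans (le_normr_Rintegral _ intD))//.
have Fosc z : x <= z <= y -> `|F z - F x| <= W.
  move=> /andP[xz zy]; have z2 := le_trans zy y2.
  rewrite Ff// (le_trans (le_normr_Rintegral _ _))//.
    exact: integrable_subsegment intf.
  rewrite /W (segment_integral_cat xz zy) ?sub// lerDl.
  exact: Rintegral_ge0.
have Gosc z : x <= z <= y -> `|G z - G y| <= M * (y - x).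
  move=> /[dup] /in01 /andP[z0 z2] /andP[xz zy].
  rewrite distrC Gg// (le_trans (le_normr_Rintegral _ _))//.
    exact: integrable_subsegment intg.
  have h : \int[mu]_(t in `[z, y]) `|g t| <= M * (y - z).
    apply: segment_integral_le_cst => //.
      apply: integrable_abs; exact: integrable_subsegment intg.
    move=> t /andP[zt ty]; apply: gM.
    by rewrite (le_trans z0)//= (le_trans ty).
  by rewrite (le_trans h)// ler_wpM2l// lerB.
have i3 : mu.-integrable `[x, y] (EFin \o (fun z => `|f z| * (M * (y - x)))).
  by apply: integrable_scaler => //; exact: sub.
have bd : \int[mu]_(t in `[x, y])
    `|f t * G t + F t * g t - (f t * G y + F x * g t)| <=
    \int[mu]_(t in `[x, y]) (`|f t| * (M * (y - x)) + W * M).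
  apply: le_Rintegral => //.
  - exact: integrable_abs.
  - apply: (integrable_add _ i3) => //; exact: segment_integrable_cst.
  move=> z /=; rewrite in_itv/= => zxy.
  have -> : f z * G z + F z * g z - (f z * G y + F x * g z) =
    f z * (G z - G y) + (F z - F x) * g z by ring.
  rewrite (le_trans (ler_normD _ _))// !normrM lerD//.
    by rewrite ler_wpM2l// Gosc.
  by rewrite ler_pM// ?Fosc// gM// in01.
apply: (le_trans bd); rewrite RintegralD//; last first.
  exact: segment_integrable_cst.
rewrite RintegralZr ?sub// Rintegral_cst// segment_measure//.
rewrite -/W le_eqVlt; apply/orP; left; apply/eqP; ring.
Qed.

(** On the open cell F differs by a constant from the integral of its density, which
the Lebesgue differentiation theorem differentiates at almost every point. *)
Lemma ac_derive F f : ac F f ->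
  \forall x \ae mu, 0 < x < 2 * pi -> is_derive x 1 F (f x).
Proof.
move=> [intf Ff].
pose fc := f \_ cell.
have intfc (D : set (measurableTypeR R)) : measurable D -> mu.-integrable D (EFin \o fc).
  move=> mD; apply: (integrableS measurableT) => //.
  rewrite /fc -restrict_EFin; apply/integrable_restrict => //=.
    exact: measurable_itv.
  by rewrite setTI.
have locf : locally_integrable [set: R] fc.
  by apply: (integrable_locally _ intf); exact: measurable_itv.
have intI (y : R) : mu.-integrable [set` Interval (BLeft 0) (BRight y)] (EFin \o fc).
  by apply: intfc; exact: measurable_itv.
have := FTC1 intI locf.
apply: filterS; first exact: (ae_filter_ringOfSetsType mu).
move=> x /= h /andP[x0 x2].
have [] := h _; first by rewrite lte_fin.
set Q := fun y : R => _ => dQ Q'.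
have {}Q' : is_derive x 1 Q (f x).
  apply: DeriveDef => //; rewrite -derive1E Q' /fc patchE mem_set//.
  by rewrite /cell/= in_itv/= !ltW.
have : is_derive x 1 (fun y => Q y + F 0) (f x).
  by have := is_deriveD Q' (is_derive_cst (F 0) x 1); rewrite addr0.
apply: near_eq_is_derive.
have : \forall y \near x, y \in `]0, 2 * pi[%R by apply: near_in_itvoo; rewrite in_itv/= x0.
apply: filterS => y; rewrite in_itv/= => /andP[y0 y2].
suff -> : Q y = F y - F 0 by rewrite subrK.
rewrite (Ff 0 y (lexx 0) (ltW y0) (ltW y2)) /Q.
apply: eq_Rintegral => z; rewrite inE/= in_itv/= => /andP[z0 zy].
by rewrite /fc patchE mem_set// /cell/= in_itv/= z0 (le_trans zy)// ltW.
Qed.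

End AbsolutelyContinuous.

(** * Rules for functions in applied form *)

Section PointwiseRules.
Context {R : realType}.
Implicit Types (f g : R -> R) (x a b c : R).

Lemma is_derive_val f x a b : is_derive x 1 f a -> a = b -> is_derive x 1 f b.
Proof. by move=> df <-. Qed.

Lemma is_derive_addr f g x a b : is_derive x 1 f a -> is_derive x 1 g b ->
  is_derive x 1 (fun y => f y + g y) (a + b).
Proof. exact: is_deriveD. Qed.

Lemma is_derive_subr f g x a b : is_derive x 1 f a -> is_derive x 1 g b ->
  is_derive x 1 (fun y => f y - g y) (a - b).
Proof. exact: is_deriveB. Qed.

Lemma is_derive_constr c x : is_derive x 1 (fun=> c) 0.
Proof. exact: is_derive_cst. Qed.

Lemma within_continuousD (A : set R) f g : {within A, continuous f} ->
  {within A, continuous g} -> {within A, continuous (fun x => f x + g x)}.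
Proof. by move=> cf cg x; apply: cvgD; [exact: cf|exact: cg]. Qed.

Lemma within_continuousB (A : set R) f g : {within A, continuous f} ->
  {within A, continuous g} -> {within A, continuous (fun x => f x - g x)}.
Proof. by move=> cf cg x; apply: cvgB; [exact: cf|exact: cg]. Qed.

Lemma within_continuousM (A : set R) f g : {within A, continuous f} ->
  {within A, continuous g} -> {within A, continuous (fun x => f x * g x)}.
Proof. by move=> cf cg x; apply: cvgM; [exact: cf|exact: cg]. Qed.

Lemma within_continuousX (A : set R) f n : {within A, continuous f} ->
  {within A, continuous (fun x => f x ^+ n)}.
Proof.
move=> cf; elim: n => [|n IH].
  by under eq_fun do rewrite expr0; move=> x; exact: cvg_cst.
by under eq_fun do rewrite exprS; exact: within_continuousM.
Qed.

Lemma within_continuous_norm (A : set R) f : {within A, continuous f} ->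
  {within A, continuous (fun x => `|f x|)}.
Proof. by move=> cf x; apply: cvg_norm; exact: cf. Qed.

Lemma within_continuous_cst (A : set R) c : {within A, continuous (fun=> c)}.
Proof. by move=> x; exact: cvg_cst. Qed.

Lemma segment_derive_continuous f (f' : R -> R) a b :
  (forall x, a <= x <= b -> is_derive x 1 f (f' x)) ->
  {within `[a, b], continuous f}.
Proof.
move=> df; apply: derivable_within_continuous => x.
by rewrite in_itv/= => /df[].
Qed.

End PointwiseRules.

(** Decomposes polynomial expressions; the atoms are closed by the context. *)
Ltac within_cont := lazymatch goal with
  | |- forall x, @continuous_at _ _ x (from_subspace _ (fun y => @?f y - @?g y)) =>
      apply: within_continuousB; within_cont
  | |- forall x, @continuous_at _ _ x (from_subspace _ (fun y => @?f y + @?g y)) =>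
      apply: within_continuousD; within_cont
  | |- forall x, @continuous_at _ _ x (from_subspace _ (fun y => @?f y * @?g y)) =>
      apply: within_continuousM; within_cont
  | |- forall x, @continuous_at _ _ x (from_subspace _ (fun y => @?f y ^+ _)) =>
      apply: within_continuousX; within_cont
  | |- forall x, @continuous_at _ _ x (from_subspace _ (fun y => `|@?f y|)) =>
      apply: within_continuous_norm; within_cont
  | |- _ => first [assumption | apply: within_continuous_cst]
  end.

(** * Cauchy-Schwarz and the quadratic norms *)

Section CauchySchwarz.
Context {R : realType}.
Notation mu := (@lebesgue_measure R).
Implicit Types (f g : R -> R).

(** The quadratic polynomial in c is minimal at c = - B / C. When C = 0 it is affine,
and would be negative somewhere if B were not 0. *)
Lemma discriminant_le (A B C : R) : 0 <= A -> 0 <= C ->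
  (forall c, 0 <= A + 2 * c * B + c ^+ 2 * C) -> B ^+ 2 <= A * C.
Proof.
move=> A0 C0 h; have [C1|C1] := ltP 0 C.
  have := h (- (B / C)).
  have -> : A + 2 * (- (B / C)) * B + (- (B / C)) ^+ 2 * C = (A * C - B ^+ 2) / C.
    by field; rewrite gt_eqF.
  by rewrite pmulr_lge0 ?invr_gt0// subr_ge0.
have {}C0 : C = 0 by apply/eqP; rewrite eq_le C1.
have [->|B0] := eqVneq B 0; first by rewrite C0 expr0n mulr0.
have := h (- ((A + 1) / (2 * B))); rewrite C0 !mulr0 addr0.
have -> : A + 2 * (- ((A + 1) / (2 * B))) * B = -1 by field.
by rewrite oppr_ge0 ler10.
Qed.

Lemma Cauchy_Schwarz f g (D : set (measurableTypeR R)) : measurable D ->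
  mu.-integrable D (EFin \o (fun x => f x ^+ 2)) ->
  mu.-integrable D (EFin \o (fun x => g x ^+ 2)) ->
  mu.-integrable D (EFin \o (fun x => f x * g x)) ->
  (\int[mu]_(x in D) (f x * g x)) ^+ 2 <=
    \int[mu]_(x in D) f x ^+ 2 * \int[mu]_(x in D) g x ^+ 2.
Proof.
move=> mD if2 ig2 ifg.
have sq (h : R -> R) : 0 <= \int[mu]_(x in D) h x ^+ 2.
  by apply: Rintegral_ge0 => x _; exact: sqr_ge0.
apply: discriminant_le => // c.
have i1 := integrable_scale (2 * c) mD ifg.
have i2 := integrable_scale (c ^+ 2) mD ig2.
rewrite -!RintegralZl// -RintegralD// -RintegralD//; last exact: integrable_add.
have := sq (fun x => f x + c * g x); congr (_ <= _).
by apply: eq_Rintegral => x _; ring.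
Qed.

Lemma Lqnorm_ge0 q f : 0 <= Lqnorm q f.
Proof. by rewrite /Lqnorm fine_ge0// Lnorm_ge0. Qed.

(** Valid for every f: if the norm is infinite, both sides are 0 by the convention
on the finite part of an extended real. *)
Lemma Lqnorm2_sqr f :
  Lqnorm 2%:E f ^+ 2 = \int[mu]_(x in cell) f x ^+ 2.
Proof.
rewrite /Lqnorm /Rintegral.
have : ('N[mu]_2%:E[EFin \o (f \_ cell)] `^ 2 =
    \int[mu]_(x in cell) (f x ^+ 2)%:E)%E.
  rewrite powR_Lnorm// [RHS]integral_mkcond; apply: eq_integral => x _ /=.
  rewrite !patchE; case: ifPn => _; last by rewrite /= normr0 powR0.
  by rewrite /= powR_mulrn ?normr_ge0// real_normK ?num_real.
move <-; case: ('N[mu]_2%:E[_])%E (Lnorm_ge0 mu 2%:E (EFin \o (f \_ cell))) => [r| |]//=.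
  by rewrite lee_fin => r0; rewrite powR_mulrn.
by rewrite expr0n /= pnatr_eq0.
Qed.

End CauchySchwarz.

(** * The Wirtinger inequality *)

Section Wirtinger.
Context {R : realType}.
Notation mu := (@lebesgue_measure R).
Implicit Types (f g : R -> R) (l c p q x : R).

Lemma is_derive_tan_affine l c x : 0 < l < 1 -> `|x - c| <= pi / 2 ->
  is_derive x 1 (fun y => tan (l * (y - c))) (l * (1 + tan (l * (x - c)) ^+ 2)).
Proof.
move=> /andP[l0 l1] xc.
have ph : 0 < pi / 2 :> R by rewrite divr_gt0// pi_gt0.
have cos0 : cos (l * (x - c)) != 0.
  rewrite gt_eqF// cos_gt0_pihalf// -ltr_norml normrM gtr0_norm//.
  by rewrite (le_lt_trans (ler_wpM2l (ltW l0) xc))// gtr_pMl.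
have dl : is_derive x 1 (fun y => l * (y - c)) l.
  apply: is_derive_val; rewrite /GRing.scale/=.
  by ring.
have := @is_derive1_comp _ tan (fun y => l * (y - c)) x _ _ (is_derive_tan cos0) dl.
by rewrite cos2_tan2// mulrC.
Qed.

(** Expand 0 <= (g' + l g tan (l (x - c)))^2. Up to g'^2 - l^2 g^2 this is the
derivative of l g^2 tan (l (x - c)), as tan' = 1 + tan^2. A factor l below 1
keeps the tangent finite up to the ends of a segment of half-length pi / 2. *)
Lemma Wirtinger_piece g (g' : R -> R) p q c l : p <= q -> 0 < l < 1 ->
  (forall x, p <= x <= q -> `|x - c| <= pi / 2) ->
  (forall x, p <= x <= q -> is_derive x 1 g (g' x)) ->
  {within `[p, q], continuous g'} ->
  l ^+ 2 * \int[mu]_(x in `[p, q]) g x ^+ 2 <=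
  \int[mu]_(x in `[p, q]) g' x ^+ 2
    + (l * g q ^+ 2 * tan (l * (q - c)) - l * g p ^+ 2 * tan (l * (p - c))).
Proof.
move=> pq l01 pc dg cg'.
pose T y := tan (l * (y - c)).
have dT x : p <= x <= q -> is_derive x 1 T (l * (1 + T x ^+ 2)).
  by move=> /pc; exact: is_derive_tan_affine.
have cg := segment_derive_continuous dg.
have cT := segment_derive_continuous dT.
pose k x := l * (2 * g x * g' x * T x + g x ^+ 2 * (l * (1 + T x ^+ 2))).
have dK x : p <= x <= q -> is_derive x 1 (fun y => l * (g y * g y) * T y) (k x).
  move=> xpq; have dgx := dg x xpq; have dTx := dT x xpq.
  apply: is_derive_val; rewrite /GRing.scale/=.
  by rewrite /k; ring.
have ck : {within `[p, q], continuous k} by rewrite /k; within_cont.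
have Kint := segment_FTC pq ck dK.
have ig : mu.-integrable `[p, q] (EFin \o (fun x => g x ^+ 2)).
  by apply: continuous_segment_integrable; within_cont.
have ig' : mu.-integrable `[p, q] (EFin \o (fun x => g' x ^+ 2)).
  by apply: continuous_segment_integrable; within_cont.
have ik := continuous_segment_integrable ck.
rewrite -RintegralZl// !expr2 -/(T p) -/(T q) -Kint -RintegralD//.
apply: le_Rintegral => //.
- by apply: continuous_segment_integrable; within_cont.
- by apply: continuous_segment_integrable; within_cont.
move=> x _; rewrite -subr_ge0.
have -> : g' x * g' x + k x - l * l * (g x * g x) = (g' x + l * g x * T x) ^+ 2.
  by rewrite /k; ring.
exact: sqr_ge0.
Qed.

Lemma le_of_contraction (A B : R) : 0 <= B ->
  (forall l, 0 < l < 1 -> l ^+ 2 * A <= B) -> A <= B.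
Proof.
move=> B0 h; rewrite leNgt; apply/negP => BA.
have A0 : 0 < A by exact: le_lt_trans BA.
(* l^2 - B / A = (1 - l)^2 for this l. *)
pose l := (1 + B / A) / 2.
have BA0 : 0 <= B / A by rewrite divr_ge0// ltW.
have BA1 : B / A < 1 by rewrite ltr_pdivrMr// mul1r.
have l01 : 0 < l < 1 by apply/andP; rewrite /l; split; lra.
have := h l l01; rewrite -ler_pdivlMr// leNgt => /negP; apply.
rewrite -subr_gt0.
have -> : l ^+ 2 - B / A = (1 - l) ^+ 2.
  have -> : B / A = 2 * l - 1 by rewrite /l; lra.
  by ring.
by rewrite exprn_gt0// subr_gt0; case/andP: l01.
Qed.

(** The function f (x + pi) - f x takes opposite values at 0 and pi, so that f takes
the same value at some a and a + pi. As f has mean zero, subtracting this value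
only increases the left-hand side. The difference g vanishes at a and a + pi, so
in the sum of Wirtinger_piece over the segments from 0 to a, from a to a + pi and
from a + pi to 2 pi only the boundary terms at 0 and 2 pi remain. They cancel by
periodicity, and l tends to 1. *)
Lemma Wirtinger f (f' : R -> R) :
  (forall x, 0 <= x <= 2 * pi -> is_derive x 1 f (f' x)) ->
  {within cell, continuous f'} ->
  f (2 * pi) = f 0 -> \int[mu]_(x in cell) f x = 0 ->
  \int[mu]_(x in cell) f x ^+ 2 <= \int[mu]_(x in cell) f' x ^+ 2.
Proof.
move=> df cf' f2 f0.
have pi0 : 0 < pi :> R by exact: pi_gt0.
have cf := segment_derive_continuous df.
have [a /andP[a0 api] fa] : exists2 a, 0 <= a <= pi & f (a + pi) = f a.
  pose q x := f (x + pi) - f x.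
  have cq : {within `[0, pi], continuous q}.
    apply: (@segment_derive_continuous _ _ (fun x => f' (x + pi) - f' x)) => x /andP[x0 xpi].
    apply: is_derive_subr; last by apply: df; apply/andP; split; lra.
    have dfx : is_derive (x + pi) 1 f (f' (x + pi)).
      by apply: df; apply/andP; split; lra.
    have := @is_derive1_comp _ f (fun y => y + pi) x _ _ dfx
      (is_derive_addr (is_derive_id x 1) (is_derive_constr pi x)).
    by rewrite addr0 mulr1.
  have q0 : q 0 = - q pi.
    by rewrite /q add0r opprB -f2; congr (_ - f _); ring.
  have [|a] := IVT (ltW pi0) cq (v := 0).
    rewrite q0 ge_min le_max; case: (leP 0 (q pi)) => [h|/ltW h].
      by rewrite oppr_le0 h orbT.
    by rewrite oppr_ge0 h orbT.
  rewrite in_itv/= => ha qa; exists a => //.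
  by apply/eqP; rewrite -subr_eq0; apply/eqP.
pose g x := f x - f a.
have dg x : 0 <= x <= 2 * pi -> is_derive x 1 g (f' x).
  move=> /df dfx; apply: is_derive_val; rewrite /GRing.scale/=.
  by rewrite subr0.
have cg := segment_derive_continuous dg.
have int_sq (h : R -> R) : {within cell, continuous h} ->
    mu.-integrable cell (EFin \o (fun x => h x ^+ 2)).
  by move=> ch; apply: continuous_segment_integrable; within_cont.
apply: (@le_trans _ _ (\int[mu]_(x in cell) g x ^+ 2)).
  have -> : \int[mu]_(x in cell) g x ^+ 2 =
      \int[mu]_(x in cell) (f x ^+ 2 + (f a ^+ 2 - 2 * f a * f x)).
    by apply: eq_Rintegral => x _; rewrite /g; ring.
  have i0 : mu.-integrable cell (EFin \o (fun x => 2 * f a * f x)).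
    by apply: continuous_segment_integrable; within_cont.
  have ic : mu.-integrable cell (EFin \o (fun x : R => f a ^+ 2)).
    exact: segment_integrable_cst.
  rewrite RintegralD ?int_sq//; last exact: integrable_sub.
  rewrite RintegralB// RintegralZl//; last exact: continuous_segment_integrable.
  rewrite f0 mulr0 subr0 lerDl; apply: Rintegral_ge0 => x _; exact: sqr_ge0.
apply: le_of_contraction; first by apply: Rintegral_ge0 => x _; exact: sqr_ge0.
move=> l l01.
have split_cell (h : R -> R) : mu.-integrable cell (EFin \o h) ->
    \int[mu]_(x in cell) h x = \int[mu]_(x in `[0, a]) h x +
      (\int[mu]_(x in `[a, a + pi]) h x + \int[mu]_(x in `[a + pi, 2 * pi]) h x).
  move=> ih; have ih' : mu.-integrable `[a, 2 * pi] (EFin \o h).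
    exact: integrable_subsegment ih.
  rewrite (segment_integral_cat (b := a) _ _ ih)//; last by lra.
  by rewrite (segment_integral_cat (b := a + pi) _ _ ih')//; lra.
rewrite !split_cell ?int_sq//.
have piece p q c : 0 <= p -> p <= q -> q <= 2 * pi ->
    (forall x, p <= x <= q -> `|x - c| <= pi / 2) ->
    l ^+ 2 * \int[mu]_(x in `[p, q]) g x ^+ 2 <=
    \int[mu]_(x in `[p, q]) f' x ^+ 2
      + (l * g q ^+ 2 * tan (l * (q - c)) - l * g p ^+ 2 * tan (l * (p - c))).
  move=> p0 pq q2 pc; apply: Wirtinger_piece => //.
    by move=> x /andP[px xq]; apply: dg; apply/andP; split; lra.
  exact: continuous_subsegment cf'.
have ga : g a = 0 by rewrite /g subrr.
have gpi : g (a + pi) = 0 by rewrite /g fa subrr.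
have g2 : g (2 * pi) = g 0 by rewrite /g f2.
have := piece 0 a (a - pi / 2) (lexx _) a0.
have := piece a (a + pi) (a + pi / 2) a0.
have := piece (a + pi) (2 * pi) (a + pi + pi / 2).
rewrite ga gpi g2.
have -> : 2 * pi - (a + pi + pi / 2) = 0 - (a - pi / 2) :> R by field.
move=> h3 h2 h1.
have near_mid (c x : R) : c - pi / 2 <= x <= c + pi / 2 -> `|x - c| <= pi / 2.
  by clear; move=> /andP[xp xq]; rewrite ler_norml; apply/andP; split; lra.
have {}h1 := h1 ltac:(clear -a0 api; lra).
have {}h2 := h2 ltac:(clear -pi0; lra) ltac:(clear -a0 api; lra).
have {}h3 := h3 ltac:(clear -a0 pi0; lra) ltac:(clear -api; lra) ltac:(by []).
have {}h1 : _ := h1 ltac:(move=> x /andP[xp xq]; apply: near_mid;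
  clear -xp xq api; apply/andP; split; lra).
have {}h2 : _ := h2 ltac:(move=> x /andP[xp xq]; apply: near_mid;
  clear -xp xq; apply/andP; split; lra).
have {}h3 : _ := h3 ltac:(move=> x /andP[xp xq]; apply: near_mid;
  clear -xp xq a0; apply/andP; split; lra).
move: h1 h2 h3; rewrite expr0n !mulr0 !mul0r !subr0 !sub0r !addr0 !mulrDr.
move: (tan _) => tt; clear; lra.
Qed.

End Wirtinger.

(** * The energy estimate at a fixed time *)

Section StaticEstimate.
Context {R : realType}.
Notation mu := (@lebesgue_measure R).
Implicit Types (f g : R -> R) (a b x y M N Y : R).

(** The integral of g - f is that of its absolute value. *)
Lemma le_Rintegral_ae f g (D : set (measurableTypeR R)) : measurable D ->
  mu.-integrable D (EFin \o f) -> mu.-integrable D (EFin \o g) ->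
  (\forall x \ae mu, D x -> f x <= g x) ->
  \int[mu]_(x in D) f x <= \int[mu]_(x in D) g x.
Proof.
move=> mD intf intg fg; rewrite -subr_ge0 -RintegralB//.
have intB := integrable_sub mD intg intf.
have -> : \int[mu]_(x in D) (g x - f x) = \int[mu]_(x in D) `|g x - f x|.
  congr fine; apply: ae_eq_integral => //.
  - exact: measurable_int intB.
  - exact: measurable_int (integrable_abs intB).
  apply: filterS fg => x fg Dx.
  by rewrite ger0_norm// subr_ge0 fg.
exact: Rintegral_ge0.
Qed.

(** The essential supremum is finite because f is bounded on the cell; otherwise its
finite part would be 0. *)
Lemma continuous_le_Lqnormy f : {within cell, continuous f} ->
  \forall x \ae mu, cell x -> `|f x| <= Lqnorm +oo%E f.
Proof.
move=> cf; have [M M0 fM] := continuous_segment_bounded cf.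
have muT : (0 < mu [set: measurableTypeR R])%E.
  by rewrite -set_itvNyy lebesgue_measure_itv/= ?ltNyy ?ltry.
rewrite /Lqnorm; set e := 'N[mu]_+oo[_]%E.
have eE : e = ess_sup mu (abse \o (EFin \o (f \_ cell))).
  by rewrite /e unlock /Lnorm muT.
have e0 : (0 <= e)%E by exact: Lnorm_ge0.
have eM : (e <= M%:E)%E.
  rewrite eE; apply/ess_supP/nearW => x /=; rewrite patchE.
  case: ifPn => [|_]; last by rewrite /= normr0 lee_fin.
  by rewrite inE/= lee_fin /cell/= in_itv/=; exact: fM.
have efin : e \is a fin_num by rewrite ge0_fin_numE// (le_lt_trans eM)// ltry.
have := ess_sup_ge mu (abse \o (EFin \o (f \_ cell))); rewrite -eE.
apply: filterS => x /= + cx.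
by rewrite patchE mem_set//= -(fineK efin) lee_fin.
Qed.

Lemma le_of_sqr a b : 0 <= b -> a ^+ 2 <= b ^+ 2 -> a <= b.
Proof.
move=> b0 h; rewrite (le_trans (ler_norm a))// -(@ler_pXn2r _ 2)// ?nnegrE//.
by rewrite real_normK ?num_real.
Qed.

Lemma integral_abs_mul_le f g a b : {within cell, continuous f} ->
  {within cell, continuous g} -> 0 <= a -> 0 <= b ->
  \int[mu]_(x in cell) f x ^+ 2 = a ^+ 2 ->
  \int[mu]_(x in cell) g x ^+ 2 = b ^+ 2 ->
  \int[mu]_(x in cell) (`|f x| * `|g x|) <= a * b.
Proof.
move=> cf cg a0 b0 fa gb; apply: le_of_sqr; first exact: mulr_ge0.
have sqa (h : R -> R) : \int[mu]_(x in cell) `|h x| ^+ 2 = \int[mu]_(x in cell) h x ^+ 2.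
  by apply: eq_Rintegral => x _; rewrite real_normK ?num_real.
rewrite exprMn -fa -gb -(sqa f) -(sqa g); apply: Cauchy_Schwarz.
- exact: measurable_itv.
- by apply: continuous_segment_integrable; within_cont.
- by apply: continuous_segment_integrable; within_cont.
- by apply: continuous_segment_integrable; within_cont.
Qed.

(** The derivative of f^2 is 2 f f'. Integrate it from the zero z to x and apply the
Cauchy-Schwarz inequality on the whole cell. *)
Lemma sup_interpolation f (f' : R -> R) Y b z x : 0 <= Y -> 0 <= b ->
  (forall x, 0 <= x <= 2 * pi -> is_derive x 1 f (f' x)) ->
  {within cell, continuous f'} ->
  \int[mu]_(x in cell) f x ^+ 2 = Y ^+ 2 ->
  \int[mu]_(x in cell) f' x ^+ 2 = b ^+ 2 ->
  0 <= z <= 2 * pi -> f z = 0 -> 0 <= x <= 2 * pi ->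
  f x ^+ 2 <= 2 * (Y * b).
Proof.
move=> Y0 b0 df cf' fY fb z2 fz x2.
have cf := segment_derive_continuous df.
have ac2 : ac (fun y => f y * f y) (fun y => 2 * (f y * f' y)).
  apply: ac_C1; first by within_cont.
  move=> y /df dfy; apply: is_derive_val; rewrite /GRing.scale/=; ring.
have := ac_osc ac2 x2 z2; rewrite fz mulr0 subr0 => h.
rewrite expr2 (le_trans (ler_norm _))// (le_trans h)//.
have -> : \int[mu]_(y in cell) `|2 * (f y * f' y)| =
    \int[mu]_(y in cell) (2 * (`|f y| * `|f' y|)).
  by apply: eq_Rintegral => y _; rewrite !normrM ger0_norm.
rewrite RintegralZl//; last by apply: continuous_segment_integrable; within_cont.
by rewrite ler_wpM2l// integral_abs_mul_le.
Qed.

Lemma binomial8_ge x y : 0 <= x -> 0 <= y -> 8 * x ^+ 7 * y <= (x + y) ^+ 8.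
Proof.
move=> x0 y0.
have -> : (x + y) ^+ 8 = 8 * x ^+ 7 * y + (x ^+ 8 + 28 * x ^+ 6 * y ^+ 2
  + 56 * x ^+ 5 * y ^+ 3 + 70 * x ^+ 4 * y ^+ 4 + 56 * x ^+ 3 * y ^+ 5
  + 28 * x ^+ 2 * y ^+ 6 + 8 * x * y ^+ 7 + y ^+ 8) by ring.
by rewrite lerDl !addr_ge0// ?mulr_ge0// ?exprn_ge0.
Qed.

(** With x = b^2 / 4 and y = K a^10, the eighth power of the left-hand side is
16 b^4 Y^20 <= 16 a^10 b^14, while (x + y)^8 >= 8 x^7 y = 8 (7^7 / 4^8) a^10 b^14.
Comparing eighth powers avoids the fractional exponents of the inequality of
Young. *)
Lemma cubic_Young a b Y M : 0 <= a -> 0 <= b -> 0 <= Y -> 0 <= M ->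
  M ^+ 2 = 2 * (Y * b) -> Y ^+ 2 <= a * b ->
  M * Y ^+ 2 <= 4^-1 * b ^+ 2 + 7 ^+ 7 / 4 * a ^+ 10.
Proof.
move=> a0 b0 Y0 M0 M2 Y2.
set x := 4^-1 * b ^+ 2; set y := _ * a ^+ 10.
have x0 : 0 <= x by rewrite mulr_ge0// ?exprn_ge0.
have y0 : 0 <= y by rewrite mulr_ge0// ?exprn_ge0// divr_ge0.
rewrite -(@ler_pXn2r _ 8)// ?nnegrE ?addr_ge0 ?mulr_ge0 ?exprn_ge0//.
apply: le_trans (binomial8_ge x0 y0).
have -> : (M * Y ^+ 2) ^+ 8 = 16 * b ^+ 4 * (Y ^+ 2) ^+ 10.
  have -> : (M * Y ^+ 2) ^+ 8 = (M ^+ 2) ^+ 4 * Y ^+ 16 by ring.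
  by rewrite M2; ring.
have Y10 : (Y ^+ 2) ^+ 10 <= (a * b) ^+ 10.
  by rewrite ler_pXn2r ?nnegrE ?exprn_ge0 ?mulr_ge0.
apply: (@le_trans _ _ (16 * b ^+ 4 * (a * b) ^+ 10)).
  by rewrite ler_wpM2l// mulr_ge0// exprn_ge0.
have -> : 8 * x ^+ 7 * y = (8 * 7 ^+ 7 / 4 ^+ 8) * (b ^+ 4 * (a * b) ^+ 10).
  by rewrite /x /y; field.
rewrite -mulrA ler_wpM2r ?mulr_ge0 ?exprn_ge0 ?mulr_ge0//.
by lra.
Qed.

(** Here D4 stands for the fourth derivative of the error and Rs for the residual.
The nonlinear part of the integrand is
d2^3 + P2 d2^2 - 2 P2 d1 d3 plus the derivative of
d1 d2^2 + P1 d2^2 + 2 d1 d2 P2, whose integral vanishes by periodicity. *)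
Lemma energy_estimate (d1 d2 d3 D4 P1 P2 P3 Rs : R -> R) a b N M :
  (forall x, 0 <= x <= 2 * pi -> is_derive x 1 d1 (d2 x)) ->
  (forall x, 0 <= x <= 2 * pi -> is_derive x 1 d2 (d3 x)) ->
  (forall x, 0 <= x <= 2 * pi -> is_derive x 1 P1 (P2 x)) ->
  (forall x, 0 <= x <= 2 * pi -> is_derive x 1 P2 (P3 x)) ->
  ac d3 D4 -> {within cell, continuous P3} ->
  mu.-integrable cell (EFin \o Rs) ->
  d1 (2 * pi) = d1 0 -> d2 (2 * pi) = d2 0 -> d3 (2 * pi) = d3 0 ->
  P1 (2 * pi) = P1 0 -> P2 (2 * pi) = P2 0 ->
  0 <= a -> 0 <= b -> 0 <= N ->
  \int[mu]_(x in cell) d1 x ^+ 2 = a ^+ 2 ->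
  \int[mu]_(x in cell) d3 x ^+ 2 = b ^+ 2 ->
  (\forall x \ae mu, cell x -> `|P2 x| <= N) ->
  \int[mu]_(x in cell) (Rs x * d2 x) <= M * b ->
  \int[mu]_(x in cell) ((D4 x + Rs x + (2 * d2 x ^+ 2 + 4 * d2 x * P2 x
    + 2 * d1 x * d3 x + 2 * d1 x * P3 x + 2 * P1 x * d3 x)) * d2 x) <=
  - (4^-1 * b ^+ 2) + 7 ^+ 7 / 4 * a ^+ 10 + M ^+ 2 + 9 * a ^+ 2 * N ^+ 2.
Proof.
move=> dd1 dd2 dP1 dP2 acd3 cP3 iRs d1e d2e d3e P1e P2e a0 b0 N0 da db PN RM.
have cd1 := segment_derive_continuous dd1.
have cd2 := segment_derive_continuous dd2.
have cd3 := ac_continuous acd3.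
have cP1 := segment_derive_continuous dP1.
have cP2 := segment_derive_continuous dP2.
have ci (f : R -> R) : {within cell, continuous f} -> mu.-integrable cell (EFin \o f).
  exact: continuous_segment_integrable.
pose Y := Num.sqrt (\int[mu]_(x in cell) d2 x ^+ 2).
have Y0 : 0 <= Y by exact: sqrtr_ge0.
have dY : \int[mu]_(x in cell) d2 x ^+ 2 = Y ^+ 2.
  by rewrite sqr_sqrtr//; apply: Rintegral_ge0 => x _; exact: sqr_ge0.
have i13 : mu.-integrable cell (EFin \o (fun x => `|d1 x| * `|d3 x|)).
  by apply: ci; within_cont.
have le13 := integral_abs_mul_le cd1 cd3 a0 b0 da db.
have Y2 : Y ^+ 2 <= a * b.
  have acd2 := ac_C1 cd3 dd2.
  have := ac_prod (ac_C1 cd2 dd1) cd3 dd2.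
  rewrite d1e d2e subrr -dY => h.
  have i22 : mu.-integrable cell (EFin \o (fun x => d2 x * d2 x)).
    by apply: ci; within_cont.
  have i1 : mu.-integrable cell (EFin \o (fun x => d1 x * d3 x)).
    by apply: ci; within_cont.
  move: h; rewrite RintegralD// => /eqP; rewrite addr_eq0 => /eqP h.
  have -> : \int[mu]_(x in cell) d2 x ^+ 2 =
      \int[mu]_(x in cell) (d2 x * d2 x).
    by apply: eq_Rintegral => x _; rewrite expr2.
  rewrite h; apply: le_trans le13.
  rewrite (le_trans (ler_norm _))// normrN (le_trans (le_normr_Rintegral _ i1))//.
  apply: le_Rintegral => //; first exact: integrable_abs.
  by move=> x _; rewrite normrM.
(* The dissipation: D4 is only a density of d3, hence ac_prod. *)
have D4E : \int[mu]_(x in cell) (D4 x * d2 x) = - b ^+ 2.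
  have [iD4 _] := acd3.
  have iD : mu.-integrable cell (EFin \o (fun x => D4 x * d2 x)).
    exact: integrable_mulr_continuous.
  have i33 : mu.-integrable cell (EFin \o (fun x => d3 x * d3 x)).
    by apply: ci; within_cont.
  have := ac_prod acd3 cd3 dd2; rewrite d2e d3e subrr RintegralD//.
  move=> /eqP; rewrite addr_eq0 => /eqP ->; congr (- _); rewrite -db.
  by apply: eq_Rintegral => x _; rewrite expr2.
pose Q' x := d2 x ^+ 3 + 2 * d1 x * d2 x * d3 x + P2 x * d2 x ^+ 2
  + 2 * P1 x * d2 x * d3 x + 2 * d2 x ^+ 2 * P2 x + 2 * d1 x * d3 x * P2 x
  + 2 * d1 x * d2 x * P3 x.
have cQ' : {within cell, continuous Q'} by rewrite /Q'; within_cont.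
have Q0 : \int[mu]_(x in cell) Q' x = 0.
  pose Q x := d1 x * (d2 x * d2 x) + P1 x * (d2 x * d2 x)
    + 2 * (d1 x * (d2 x * P2 x)).
  have dQ x : 0 <= x <= 2 * pi -> is_derive x 1 Q (Q' x).
    move=> x2; have h1 := dd1 x x2; have h2 := dd2 x x2.
    have h3 := dP1 x x2; have h4 := dP2 x x2.
    by apply: is_derive_val; rewrite /GRing.scale/= /Q'; ring.
  rewrite (_ : Rintegral _ _ _ = Q (2 * pi) - Q 0).
    by rewrite /Q d1e d2e P1e P2e subrr.
  exact: segment_FTC pi2_ge0 cQ' dQ.
have [z /andP[z0 z2] d2z] : exists2 z, 0 <= z <= 2 * pi & d2 z = 0.
  have pi20 : 0 < 2 * pi :> R by rewrite mulr_gt0// pi_gt0.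
  have d1d x : x \in `]0, 2 * pi[%R -> derivable d1 x 1.
    by rewrite in_itv/= => /andP[x0 x2]; have [] := dd1 x ltac:(rewrite !ltW).
  have [z zi dz] := Rolle pi20 d1d cd1 (esym d1e).
  move: zi; rewrite in_itv/= => /andP[z0 z2].
  have z02 : 0 <= z <= 2 * pi by rewrite !ltW.
  exists z => //; have := dd1 z z02 => h.
  by rewrite -(@derive_val _ _ _ _ _ _ _ h) (@derive_val _ _ _ _ _ _ _ dz).
(* S bounds d2 uniformly. *)
pose S := Num.sqrt (2 * (Y * b)).
have S0 : 0 <= S by exact: sqrtr_ge0.
have S2 : S ^+ 2 = 2 * (Y * b) by rewrite sqr_sqrtr// !mulr_ge0.
have d2S x : 0 <= x <= 2 * pi -> d2 x <= S.
  move=> x2; apply: le_of_sqr => //; rewrite S2.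
  by apply: (sup_interpolation Y0 b0 dd2 cd3 dY db (z := z)) => //; rewrite z0.
have cubic : \int[mu]_(x in cell) d2 x ^+ 3 <= S * Y ^+ 2.
  rewrite -dY -RintegralZl//; last by apply: ci; within_cont.
  apply: le_Rintegral => //.
  - by apply: ci; within_cont.
  - by apply: ci; within_cont.
  move=> x; rewrite /cell/= in_itv/= => x2.
  by rewrite exprS ler_wpM2r ?sqr_ge0// d2S.
have quad : \int[mu]_(x in cell) (P2 x * d2 x ^+ 2 - 2 * P2 x * d1 x * d3 x) <=
    N * Y ^+ 2 + 2 * N * (a * b).
  have i2 : mu.-integrable cell (EFin \o (fun x => d2 x ^+ 2)).
    by apply: ci; within_cont.
  apply: (@le_trans _ _ (\int[mu]_(x in cell)
      (N * d2 x ^+ 2 + 2 * N * (`|d1 x| * `|d3 x|)))); last first.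
    rewrite RintegralD//; [|exact: integrable_scale|exact: integrable_scale].
    by rewrite !RintegralZl// dY lerD2l// ler_wpM2l// mulr_ge0.
  apply: le_Rintegral_ae => //.
  - by apply: ci; within_cont.
  - by apply: ci; within_cont.
  move: PN; apply: filterS; first exact: (ae_filter_ringOfSetsType mu).
  move=> x /[apply] PN.
  apply: lerD.
    by rewrite ler_wpM2r ?sqr_ge0// (le_trans (ler_norm _)).
  rewrite (le_trans (ler_norm _))// normrN !normrM (ger0_norm (ler0n _ 2)).
  by rewrite -!mulrA ler_wpM2l// ler_wpM2r// mulr_ge0.
have iR2 : mu.-integrable cell (EFin \o (fun x => Rs x * d2 x)).
  exact: integrable_mulr_continuous.
have iD2 : mu.-integrable cell (EFin \o (fun x => D4 x * d2 x)).
  by apply: integrable_mulr_continuous => //; case: acd3.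
pose W x := d2 x ^+ 3 + (P2 x * d2 x ^+ 2 - 2 * P2 x * d1 x * d3 x) + Q' x.
have iW : mu.-integrable cell (EFin \o W).
  by apply: ci; rewrite /W; within_cont.
have -> : \int[mu]_(x in cell) ((D4 x + Rs x + (2 * d2 x ^+ 2 + 4 * d2 x * P2 x
    + 2 * d1 x * d3 x + 2 * d1 x * P3 x + 2 * P1 x * d3 x)) * d2 x) =
    \int[mu]_(x in cell) ((D4 x * d2 x + Rs x * d2 x) + W x).
  by apply: eq_Rintegral => x _; rewrite /W /Q'; ring.
rewrite RintegralD//; last exact: integrable_add.
rewrite (RintegralD _ iD2 iR2)// D4E /W.
rewrite RintegralD//; last 2 first.
- by apply: ci; within_cont.
- by apply: ci; within_cont.
rewrite Q0 addr0 RintegralD//; last 2 first.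
- by apply: ci; within_cont.
- by apply: ci; within_cont.
have := cubic_Young a0 b0 Y0 S0 S2 Y2.
have NY : N * Y ^+ 2 <= N * (a * b) by exact: ler_wpM2l.
(* M b <= M^2 + b^2 / 4 and 3 N a b <= 9 a^2 N^2 + b^2 / 4. *)
have sq1 : 0 <= (M - b / 2) ^+ 2 by exact: sqr_ge0.
have sq2 : 0 <= (3 * N * a - b / 2) ^+ 2 by exact: sqr_ge0.
move: (\int[mu]_(x in cell) (Rs x * d2 x)) RM => I1 RM.
move: (\int[mu]_(x in cell) (d2 x ^+ 3)) cubic => I2 cubic.
move: (\int[mu]_(x in cell) _) quad => I3 quad cY.
have e1 : (M - b / 2) ^+ 2 = M ^+ 2 - M * b + 4^-1 * b ^+ 2 by field.
have e2 : (3 * N * a - b / 2) ^+ 2 =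
    9 * a ^+ 2 * N ^+ 2 - 3 * (N * (a * b)) + 4^-1 * b ^+ 2 by field.
rewrite e1 in sq1; rewrite e2 in sq2.
have quad' : I3 <= N * Y ^+ 2 + 2 * (N * (a * b)) by rewrite [2 * (N * _)]mulrA.
move: (7 ^+ 7 / 4 * a ^+ 10) (9 * a ^+ 2 * N ^+ 2) (N * (a * b))
  (N * Y ^+ 2) (S * Y ^+ 2) (b ^+ 2) (M * b) (M ^+ 2)
  sq1 sq2 quad' NY cY cubic RM.
clear; move=> *; lra.
Qed.

End StaticEstimate.

(** * Periodic functions and the dual norm *)

Section Periodic.
Context {R : realType}.
Notation mu := (@lebesgue_measure R).
Implicit Types (f g v w : R -> R) (x y : R).

Lemma derive1_periodic f (c : R) : (forall x, f (x + c) = f x) ->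
  forall x, derive1 f (x + c) = derive1 f x.
Proof.
move=> fc x; rewrite /derive1.
have -> : (fun h => h^-1 *: (f (h + (x + c)) - f (x + c))) =
    (fun h => h^-1 *: (f (h + x) - f x)) by apply/funext => h; rewrite addrA !fc.
by [].
Qed.

Lemma derive1n_periodic f (c : R) n : (forall x, f (x + c) = f x) ->
  forall x, derive1n n f (x + c) = derive1n n f x.
Proof. by move=> fc; elim: n => [//|n IH]; exact: derive1_periodic. Qed.

Lemma periodic_at0 f (n : nat) : (forall x, f (x + 2 * pi) = f x) ->
  derive1n n f (2 * pi) = derive1n n f 0.
Proof. by move=> fc; rewrite -[in LHS](add0r (2 * pi)) derive1n_periodic. Qed.

Lemma periodic_nat f (c : R) (n : nat) : (forall x, f (x + c) = f x) ->
  forall x, f (x + n%:R * c) = f x.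
Proof.
move=> fc x; elim: n => [|n IH]; first by rewrite mul0r addr0.
by rewrite -natr1 mulrDl mul1r addrA fc.
Qed.

Lemma periodic_int f (c : R) (k : int) : (forall x, f (x + c) = f x) ->
  forall x, f (x + k%:~R * c) = f x.
Proof.
move=> fc x; case: k => n; first exact: periodic_nat.
by rewrite NegzE mulrNz mulNr -[in RHS](subrK (n.+1%:R * c) x) periodic_nat.
Qed.

(** Continuity at 0 combines the right limit at 0 with the left limit at 2 pi, which
agree by periodicity. Every other point is moved into the cell by a multiple of
the period. *)
Lemma periodic_continuous f : (forall x, f (x + 2 * pi) = f x) ->
  {within cell, continuous f} -> continuous f.
Proof.
move=> fp cf.
have pi20 : 0 < 2 * pi :> R by rewrite mulr_gt0// pi_gt0.
have [ci c0 c2] := (continuous_within_itvP f pi20).1 cf.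
have f2 : f (2 * pi) = f 0 by rewrite -[in LHS](add0r (2 * pi)) fp.
have c00 : {for 0, continuous f}.
  apply/left_right_continuousP; split => //.
  apply/cvgrPdist_lt => e e0.
  move/cvgrPdist_lt : c2 => /(_ e e0) [r /= r0 hr].
  exists r => //= z /= rz z0; have := hr (z + 2 * pi).
  rewrite /= fp f2; apply; last by rewrite -ltrBrDr subrr.
  move: rz; rewrite sub0r normrN => rz.
  by rewrite opprD addrCA subrr addr0 normrN.
move=> x; pose k := Num.floor (x / (2 * pi)).
pose y := x - k%:~R * (2 * pi).
have cy : {for y, continuous f}.
  have y0 : 0 <= y by rewrite subr_ge0 -ler_pdivlMr// real_floor_le ?num_real.
  have y2 : y < 2 * pi.
    have := real_floorD1_gt (num_real (x / (2 * pi))).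
    by rewrite ltr_pdivrMr// intrD mulrDl mul1r ltrBlDr addrC.
  move: y0; rewrite le_eqVlt => /predU1P[<-//|y0].
  by apply: ci; rewrite in_itv/= y0.
have -> : f = f \o (fun z => z - k%:~R * (2 * pi)).
  apply/funext => z /=.
  by rewrite -[RHS](periodic_int k fp) subrK.
apply: continuous_comp => //.
by apply: cvgD; [exact: cvg_id|exact: cvg_cst].
Qed.

(** As f has mean zero, f x is the average of f x - f y over y. *)
Lemma mean_zero_bound f B : {within cell, continuous f} ->
  \int[mu]_(x in cell) f x = 0 ->
  (forall x y, 0 <= x <= 2 * pi -> 0 <= y <= 2 * pi -> `|f x - f y| <= B) ->
  forall x, 0 <= x <= 2 * pi -> `|f x| <= B.
Proof.
move=> cf f0 fB x x2.
have pi20 : 0 < 2 * pi :> R by rewrite mulr_gt0// pi_gt0.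
have i1 : mu.-integrable cell (EFin \o f) by exact: continuous_segment_integrable.
have i2 : mu.-integrable cell (EFin \o (fun y => f x - f y)).
  by apply: continuous_segment_integrable; within_cont.
have e : \int[mu]_(y in cell) (f x - f y) = f x * (2 * pi).
  rewrite RintegralB//; last exact: segment_integrable_cst.
  rewrite Rintegral_cst ?f0 ?subr0//.
  by rewrite segment_measure ?subr0// ltW.
rewrite -(ler_pM2r pi20) -{1}(gtr0_norm pi20) -normrM -e.
rewrite (le_trans (le_normr_Rintegral _ i2))//.
have := @segment_integral_le_cst R (fun y => `|f x - f y|) 0 (2 * pi) B.
by rewrite subr0; apply; [exact: ltW|exact: integrable_abs|move=> y y2; exact: fB].
Qed.

Lemma Lfun2_cell f : f \_ cell \in Lfun mu 2%:E ->
  mu.-integrable cell (EFin \o f) /\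
  mu.-integrable cell (EFin \o (fun x => f x ^+ 2)).
Proof.
move=> fL.
have i2 : mu.-integrable cell (EFin \o (fun x => f x ^+ 2)).
  have := Lfun2_integrable_sqr fL.
  move/(integrableS measurableT measurable_cell (@subsetT _ _)).
  apply: eq_integrable => // x xc; rewrite /= patchE xc//.
split=> //.
have mf : measurable_fun (cell : set (measurableTypeR R)) f.
  apply/(measurable_restrictT _ measurable_cell).
  by move: fL; rewrite inE => /andP[+ _]; rewrite inE.
have i1 : mu.-integrable cell (EFin \o (fun x => 1 + f x ^+ 2)).
  by apply: integrable_add => //; exact: segment_integrable_cst.
apply: le_integrable i1 => //; first exact/measurable_EFinP.
move=> x _ /=; rewrite lee_fin [leRHS]ger0_norm ?addr_ge0 ?sqr_ge0//.
have := sqr_ge0 (`|f x| - 1); have := normr_ge0 (f x).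
rewrite sqrrB1 real_normK ?num_real//; move: (f x ^+ 2) `|f x| => s t; lra.
Qed.

Lemma continuous_Lfun2 f : {within cell, continuous f} ->
  f \_ cell \in Lfun mu 2%:E.
Proof.
move=> cf; rewrite inE; apply/andP; split; rewrite inE/=.
  apply/(measurable_restrictT _ measurable_cell).
  exact: continuous_segment_measurable.
rewrite /finite_norm.
have -> : ('N[mu]_2%:E[EFin \o (f \_ cell)] =
    (\int[mu]_(x in cell) (f x ^+ 2)%:E) `^ 2^-1)%E.
  rewrite unlock /Lnorm [in RHS]integral_mkcond; congr (_ `^ _)%E.
  apply: eq_integral => x _ /=.
  rewrite !patchE; case: ifPn => _; last by rewrite /= normr0 powR0.
  by rewrite /= powR_mulrn ?normr_ge0// real_normK ?num_real.
apply: poweR_lty.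
have : mu.-integrable cell (EFin \o (fun x => f x ^+ 2)).
  by apply: continuous_segment_integrable; within_cont.
move/integrable_fin_num => /(_ measurable_cell).
by rewrite fin_numElt => /andP[].
Qed.

Lemma Hper_ac p f : Hper p f -> ac (derive1n p.-1 f) (derive1n p f).
Proof.
move=> [_ _ _ /Lfun2_cell[i1 _] h]; split => // a b _ ab _; exact: h.
Qed.

(** By mean_zero_bound, v is at most the integral of the absolute value of v', and
|v'| <= 1 + v'^2. This crude bound makes the supremum in the dual norm one of a
bounded set. *)
Lemma Hper1_bound v : Hper 1 v -> Hnorm 1 v <= 1 ->
  forall x, 0 <= x <= 2 * pi -> `|v x| <= 2 * pi + 1.
Proof.
move=> Hv v1; have acv := Hper_ac Hv; have cv := ac_continuous acv.
have [_ v0 _ /Lfun2_cell[i1 i2] _] := Hv.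
apply: mean_zero_bound => // x y x2 y2.
rewrite (le_trans (ac_osc acv x2 y2))//.
have ic : mu.-integrable cell (EFin \o (fun x : R => 1 : R)).
  exact: segment_integrable_cst.
apply: (@le_trans _ _ (\int[mu]_(x in cell) (1 + derive1n 1 v x ^+ 2))).
  apply: le_Rintegral => //; first exact: integrable_abs.
    exact: integrable_add.
  move=> z _; have := sqr_ge0 (`|derive1n 1 v z| - 1).
  have := normr_ge0 (derive1n 1 v z).
  rewrite sqrrB1 real_normK ?num_real//; move: (_ ^+ 2) `|_| => s t; lra.
rewrite RintegralD// Rintegral_cst ?mul1r//.
rewrite segment_measure ?pi2_ge0// subr0 lerD2l.
by rewrite -Lqnorm2_sqr expr_le1 ?Lqnorm_ge0.
Qed.

(** The function w / (b + e) is admissible in the dual norm for every e > 0, also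
when b = 0; then e tends to 0. *)
Lemma Hm1norm_pairing f w (w' : R -> R) b :
  mu.-integrable cell (EFin \o f) ->
  (forall x, w (x + 2 * pi) = w x) -> \int[mu]_(x in cell) w x = 0 ->
  (forall x : R, is_derive x 1 w (w' x)) -> continuous w' ->
  0 <= b -> \int[mu]_(x in cell) w' x ^+ 2 = b ^+ 2 ->
  \int[mu]_(x in cell) (f x * w x) <= Hm1norm f * b.
Proof.
move=> intf wp w0 dw cw' b0 wb.
have cw : continuous w by apply: derivable_continuous => x; have [] := dw x.
have iw : mu.-integrable cell (EFin \o w).
  by apply/continuous_segment_integrable/continuous_subspaceT.
set J := \int[mu]_(x in cell) (f x * w x).
have test e : 0 < e -> J <= Hm1norm f * (b + e).
  move=> e0; pose c := (b + e)^-1.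
  have be0 : 0 < b + e by rewrite ltr_wpDl.
  have c0 : 0 < c by rewrite invr_gt0.
  rewrite -ler_pdivrMr// -/c.
  have ifw : mu.-integrable cell (EFin \o (fun x => f x * w x)).
    by apply: integrable_mulr_continuous => //; exact: continuous_subspaceT.
  pose v x := c * w x.
  have dv (x : R) : is_derive x 1 v (c * w' x).
    have dwx := dw x.
    by apply: is_derive_val; rewrite /GRing.scale/=; ring.
  have v'E : derive1 v = fun x => c * w' x.
    by apply/funext => x; rewrite derive1E; have dvx := dv x; rewrite derive_val.
  have cv' : continuous (derive1 v).
    by rewrite v'E => x; apply: cvgM; [exact: cvg_cst|exact: cw'].
  have Hv : Hper 1 v.
    split.
    - by move=> x; rewrite /v wp.
    - by rewrite RintegralZl ?w0 ?mulr0.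
    - by move=> k; rewrite ltn0.
    - by apply: continuous_Lfun2; exact: continuous_subspaceT.
    - move=> x y xy /=; rewrite /derive1n/= v'E; symmetry; apply: segment_FTC => //.
      by rewrite -v'E; exact: continuous_subspaceT.
  have v1 : Hnorm 1 v <= 1.
    rewrite -(@expr_le1 _ 2)// ?Lqnorm_ge0// Lqnorm2_sqr /derive1n/= v'E.
    have -> : \int[mu]_(x in cell) (c * w' x) ^+ 2 = (c * b) ^+ 2.
      rewrite exprMn -wb -RintegralZl//.
      - by apply: eq_Rintegral => x _; rewrite exprMn.
      - apply: continuous_segment_integrable; apply: within_continuousX.
        exact: continuous_subspaceT.
    have cb : c * b <= 1 by rewrite mulrC ler_pdivrMr// mul1r lerDl ltW.
    by rewrite expr_le1// mulr_ge0// ltW.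
  have -> : J * c = \int[mu]_(x in cell) (f x * v x).
    rewrite mulrC -RintegralZl//.
    by apply: eq_Rintegral => x _; rewrite /v; ring.
  apply: sup_upper_bound; last by exists v.
  split; first by exists (\int[mu]_(x in cell) (f x * v x)); exists v.
  exists (\int[mu]_(x in cell) `|f x| * (2 * pi + 1)) => _ [h [Hh h1] ->].
  have ch := ac_continuous (Hper_ac Hh).
  have ifh : mu.-integrable cell (EFin \o (fun x => f x * h x)).
    exact: integrable_mulr_continuous.
  rewrite (le_trans (ler_norm _))// (le_trans (le_normr_Rintegral _ ifh))//.
  rewrite -RintegralZr//; last exact: integrable_abs.
  apply: le_Rintegral => //; first exact: integrable_abs.
    by apply: integrable_scaler => //; exact: integrable_abs.
  move=> x; rewrite /cell/= in_itv/= => x2.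
  by rewrite normrM ler_wpM2l// (Hper1_bound Hh).
apply/ler_addgt0Pr => e e0.
pose M := `|Hm1norm f| + 1.
have M0 : 0 < M by rewrite ltr_wpDl.
apply: (le_trans (test (e / M) (divr_gt0 e0 M0))).
rewrite mulrDr lerD2l mulrCA -[leRHS]mulr1 (ler_wpM2l (ltW e0))//.
by rewrite ler_pdivrMr// mul1r (le_trans (ler_norm _))// lerDl.
Qed.

End Periodic.

(** * The fourth-order norm of differences *)

Section H4.
Context {R : realType}.
Notation mu := (@lebesgue_measure R).
Implicit Types (f g F G : R -> R) (x y c : R).

(** Unlike the pointwise fourth derivative, the density g4 is linear in g, so that
this class is closed under linear combinations. *)
Record weakH4 g (g4 : R -> R) : Prop := {
  weakH4_periodic : forall x, g (x + 2 * pi) = g x ;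
  weakH4_mean0 : \int[mu]_(x in cell) g x = 0 ;
  weakH4_derivable : forall k, (k < 3)%N -> forall x : R, derivable (derive1n k g) x 1 ;
  weakH4_L2 : g4 \_ cell \in Lfun mu 2%:E ;
  weakH4_ac : ac (derive1n 3 g) g4
}.

Lemma Hper4_weakH4 f : Hper 4 f -> weakH4 f (derive1n 4 f).
Proof. by move=> Hf; have := Hper_ac Hf; case: Hf. Qed.

Lemma derive1n_is_derive f k : (forall x : R, derivable (derive1n k f) x 1) ->
  forall x : R, is_derive x 1 (derive1n k f) (derive1n k.+1 f x).
Proof.
by move=> df x; apply: DeriveDef; [exact: df|rewrite derive1nS derive1E].
Qed.

Lemma derive1n_lin c f g n :
  (forall k, (k < n)%N -> forall x : R, derivable (derive1n k f) x 1) ->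
  (forall k, (k < n)%N -> forall x : R, derivable (derive1n k g) x 1) ->
  forall k, (k <= n)%N ->
    derive1n k (fun x => c * f x + g x) =
      (fun x => c * derive1n k f x + derive1n k g x).
Proof.
move=> df dg; elim => [//|k IH] kn; rewrite derive1nS IH ?(ltnW kn)//.
apply/funext => x; rewrite derive1E.
have h1 := derive1n_is_derive (df k kn) x.
have h2 := derive1n_is_derive (dg k kn) x.
have h : is_derive x 1 (fun x => c * derive1n k f x + derive1n k g x)
    (c * derive1n k.+1 f x + derive1n k.+1 g x).
  by apply: is_derive_val; rewrite /GRing.scale/=; ring.
by rewrite derive_val.
Qed.

Lemma derivable_lin c f g n :
  (forall k, (k < n)%N -> forall x : R, derivable (derive1n k f) x 1) ->
  (forall k, (k < n)%N -> forall x : R, derivable (derive1n k g) x 1) ->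
  forall k, (k < n)%N -> forall x : R,
    derivable (derive1n k (fun x => c * f x + g x)) x 1.
Proof.
move=> df dg k kn x; rewrite (derive1n_lin c df dg)//; last exact: ltnW.
have h1 := derive1n_is_derive (df k kn) x.
have h2 := derive1n_is_derive (dg k kn) x.
have h : is_derive x 1 (fun x => c * derive1n k f x + derive1n k g x)
    (c * derive1n k.+1 f x + derive1n k.+1 g x).
  by apply: is_derive_val; rewrite /GRing.scale/=; ring.
by have [] := h.
Qed.

Lemma weakH4_integrable g g4 : weakH4 g g4 -> mu.-integrable cell (EFin \o g).
Proof.
move=> Hg; apply/continuous_segment_integrable/continuous_subspaceT.
exact/derivable_continuous/(weakH4_derivable Hg (k := 0)).
Qed.

Lemma weakH4_lin c f f4 g g4 : weakH4 f f4 -> weakH4 g g4 ->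
  weakH4 (fun x => c * f x + g x) (fun x => c * f4 x + g4 x).
Proof.
move=> Hf Hg.
have [pf f0 df Lf acf] := Hf; have [pg g0 dg Lg acg] := Hg; split.
- by move=> x; rewrite pf pg.
- have i1 := weakH4_integrable Hf; have i2 := weakH4_integrable Hg.
  rewrite RintegralD//; last exact: integrable_scale.
  by rewrite RintegralZl// f0 g0 mulr0 addr0.
- exact: derivable_lin.
- have -> : (fun x => c * f4 x + g4 x) \_ cell =
      (c *: (f4 \_ cell) + g4 \_ cell)%R.
    apply/funext => x; rewrite patchE fctE/= /GRing.scale/= !patchE.
    case: ifPn => // _; rewrite (_ : point = 0 :> R)// /GRing.scale/=.
    by rewrite mulr0 addr0.
  have le12 : (1 <= 2%:E :> \bar R)%E by rewrite lee_fin ler1n.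
  have [_ lin] := Lfun_submod_closed mu le12.
  exact: lin.
- by rewrite (derive1n_lin c df dg)//; exact: ac_lin.
Qed.

Lemma ae_neq (a : R) : \forall x \ae mu, x != a.
Proof.
exists [set a]; split; first exact: measurable_set1.
  exact: lebesgue_measure_set1.
by move=> x /= /negP; rewrite negbK => /eqP.
Qed.

(** The third derivative is differentiable with derivative g4 at almost every point. *)
Lemma weakH4_Hnorm g g4 : weakH4 g g4 ->
  Hnorm 4 g ^+ 2 = \int[mu]_(x in cell) g4 x ^+ 2.
Proof.
move=> Hg; rewrite Lqnorm2_sqr; congr fine.
have [_ i2] := Lfun2_cell (weakH4_L2 Hg).
apply: ge0_ae_eq_integral_lower => //.
- exact: measurable_int i2.
- by move=> x _; rewrite lee_fin sqr_ge0.
- by move=> x _; rewrite lee_fin sqr_ge0.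
have h := ac_derive (weakH4_ac Hg).
move: h (ae_neq 0) (ae_neq (2 * pi)).
apply: filterS3; first exact: (ae_filter_ringOfSetsType mu).
move=> x h x0 x2 cx.
have -> : derive1n 4 g x = g4 x; last by [].
have dx : is_derive x 1 (derive1n 3 g) (g4 x).
  apply: h; move: cx; rewrite /cell/= in_itv/= !le_eqVlt eq_sym.
  by rewrite (negbTE x0) (negbTE x2).
by rewrite derive1nS derive1E derive_val.
Qed.

Lemma ac_zero_bound F f B z : ac F f -> 0 <= z <= 2 * pi -> F z = 0 ->
  (forall x, 0 <= x <= 2 * pi -> `|f x| <= B) ->
  forall x, 0 <= x <= 2 * pi -> `|F x| <= B * (2 * pi).
Proof.
move=> acF z2 Fz fB x x2; have := ac_osc acF x2 z2.
rewrite Fz subr0 => h; rewrite (le_trans h)//.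
have := @segment_integral_le_cst R (fun y => `|f y|) 0 (2 * pi) B.
by rewrite subr0; apply => //; [exact: pi2_ge0|apply: integrable_abs; case: acF].
Qed.

(** Rolle's theorem on one period. *)
Lemma periodic_derive_zero f (n : nat) : (forall x, f (x + 2 * pi) = f x) ->
  (forall x : R, derivable (derive1n n f) x 1) ->
  exists2 z, 0 <= z <= 2 * pi & derive1n n.+1 f z = 0.
Proof.
move=> fp df.
have pi20 : 0 < 2 * pi :> R by rewrite mulr_gt0// pi_gt0.
have cf : {within `[0, 2 * pi], continuous (derive1n n f)}.
  exact/continuous_subspaceT/derivable_continuous.
have [z zi dz] := Rolle pi20 (fun x _ => df x) cf (esym (periodic_at0 n fp)).
exists z; first by move: zi; rewrite in_itv/= => /andP[z0 z2]; rewrite !ltW.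
by rewrite derive1nS derive1E derive_val.
Qed.

(** Not sharp: the bounds for the function and for its first derivative are both
below this value. *)
Definition H4_const : R := Num.sqrt (2 * pi) * (1 + 2 * pi) ^+ 3.

Lemma H4_const_ge0 : 0 <= H4_const.
Proof. by rewrite mulr_ge0 ?sqrtr_ge0 ?exprn_ge0 ?addr_ge0 ?pi2_ge0. Qed.

(** The third and second derivatives and the first one vanish somewhere on the cell,
and the function has mean zero. So each order is bounded by 2 pi times the bound
of the next one, starting from the Cauchy-Schwarz inequality for the integral of
the absolute value of g4. *)
Lemma weakH4_sup g g4 k : weakH4 g g4 -> (k < 2)%N ->
  forall x, 0 <= x <= 2 * pi -> `|derive1n k g x| <= H4_const * Hnorm 4 g.
Proof.
move=> Hg k2; have [gp g0 dg L4 ac3] := Hg.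
have p2 := @pi2_ge0 R.
pose L := 2 * pi : R; pose B := Num.sqrt L * Hnorm 4 g.
have B0 : 0 <= B by rewrite mulr_ge0 ?sqrtr_ge0 ?Lqnorm_ge0.
have [i4 i42] := Lfun2_cell L4.
have g4B : \int[mu]_(x in cell) `|g4 x| <= B.
  apply: le_of_sqr => //; rewrite exprMn sqr_sqrtr// (weakH4_Hnorm Hg) mulrC.
  have ia := integrable_abs i4.
  have -> : \int[mu]_(x in cell) `|g4 x| = \int[mu]_(x in cell) (`|g4 x| * 1).
    by apply: eq_Rintegral => x _; rewrite mulr1.
  have -> : L = \int[mu]_(x in cell) (1 ^+ 2).
    by rewrite Rintegral_cst// segment_measure// expr1n mul1r subr0.
  have -> : \int[mu]_(x in cell) g4 x ^+ 2 = \int[mu]_(x in cell) `|g4 x| ^+ 2.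
    by apply: eq_Rintegral => x _; rewrite real_normK ?num_real.
  apply: Cauchy_Schwarz => //.
  - apply: eq_integrable i42 => // x _ /=.
    by rewrite real_normK ?num_real.
  - exact: segment_integrable_cst.
  - by apply: eq_integrable ia => // x _ /=; rewrite mulr1.
have D (j : nat) : (j < 3)%N -> forall x : R, is_derive x 1 (derive1n j g) (derive1n j.+1 g x).
  by move=> j3; apply: derive1n_is_derive; exact: dg.
have acj (j : nat) : (j < 3)%N -> {within cell, continuous (derive1n j.+1 g)} ->
    ac (derive1n j g) (derive1n j.+1 g).
  by move=> j3 cj; apply: (ac_C1 cj) => x _; exact: D.
have c3 := ac_continuous ac3.
have cj (j : nat) : (j < 3)%N -> {within cell, continuous (derive1n j g)}.
  by move=> j3; apply/continuous_subspaceT/derivable_continuous; exact: dg.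
have b3 x : 0 <= x <= 2 * pi -> `|derive1n 3 g x| <= B.
  have [z z2 gz] := periodic_derive_zero gp (dg 2%N isT).
  by move=> x2; have := ac_osc ac3 x2 z2; rewrite gz subr0 => /le_trans; exact.
have b2 x : 0 <= x <= 2 * pi -> `|derive1n 2 g x| <= B * L.
  have [z z2 gz] := periodic_derive_zero gp (dg 1%N isT).
  exact: ac_zero_bound (acj 2%N isT c3) z2 gz b3 x.
have b1 x : 0 <= x <= 2 * pi -> `|derive1n 1 g x| <= B * L * L.
  have [z z2 gz] := periodic_derive_zero gp (dg 0%N isT).
  exact: ac_zero_bound (acj 1%N isT (cj 2%N isT)) z2 gz b2 x.
have b0 x : 0 <= x <= 2 * pi -> `|derive1n 0 g x| <= B * L * L * L.
  have ac0 := acj 0%N isT (cj 1%N isT).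
  apply: mean_zero_bound => //; first exact: (cj 0%N isT).
  move=> y z y2 z2; rewrite (le_trans (ac_osc ac0 y2 z2))//.
  have := @segment_integral_le_cst R (fun t => `|derive1n 1 g t|) 0 L (B * L * L).
  rewrite subr0; apply => //.
  by apply: integrable_abs; case: ac0.
have HE : H4_const * Hnorm 4 g = B * (1 + L) ^+ 3 by rewrite /H4_const /B -/L; ring.
have L0 : 0 <= L by [].
move=> x x2; rewrite HE; case: k k2 => [|[|//]] _.
  apply: (le_trans (b0 x x2)).
  have -> : B * L * L * L = B * (L * (L * L)) by ring.
  rewrite ler_wpM2l//.
  have -> : (1 + L) ^+ 3 = L * (L * L) + (1 + 3 * L + 3 * L ^+ 2) by ring.
  by rewrite lerDl !addr_ge0// mulr_ge0// exprn_ge0.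
apply: (le_trans (b1 x x2)).
have -> : B * L * L = B * (L * L) by ring.
rewrite ler_wpM2l//.
have -> : (1 + L) ^+ 3 = L * L + (1 + 3 * L + 2 * L ^+ 2 + L ^+ 3) by ring.
rewrite lerDl; have := exprn_ge0 2 L0; have := exprn_ge0 3 L0.
by move: (L ^+ 2) (L ^+ 3) => s t; move: L0; clear; move=> *; lra.
Qed.

End H4.

(** * Increments in time *)

Section SmoothInTime.
Context {R : realType}.
Implicit Types (v u : R -> R -> R) (t x h : R) (tau : \bar R).

Lemma smooth_dt tau v : smooth_on tau v -> smooth_on tau (dt v).
Proof. by move=> sv n; have [_ []] := sv n.+1. Qed.

Lemma smooth_dx tau v : smooth_on tau v -> smooth_on tau (dx v).
Proof. by move=> sv n; have [_ []] := sv n.+1. Qed.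

Lemma smooth_is_derive_t tau v t x : smooth_on tau v -> 0 < t -> (t%:E < tau)%E ->
  is_derive t 1 (v ^~ x) (dt v t x).
Proof.
move=> sv t0 ttau; have [_ [d _ _]] := sv 1%N.
have [dvt _] := d t x t0 ttau.
by apply: DeriveDef; [exact: dvt|rewrite /dt derive1E].
Qed.

Lemma smooth_is_derive_x tau v t x : smooth_on tau v -> 0 < t -> (t%:E < tau)%E ->
  is_derive x 1 (v t) (dx v t x).
Proof.
move=> sv t0 ttau; have [_ [d _ _]] := sv 1%N.
have [_ dvx] := d t x t0 ttau.
by apply: DeriveDef; [exact: dvx|rewrite /dx derive1E].
Qed.

Lemma smooth_derive1n_dx tau v n : smooth_on tau v ->
  exists2 w, smooth_on tau w & forall t, derive1n n (v t) = w t.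
Proof.
move=> sv; elim: n => [|n [w sw vw]]; first by exists v.
exists (dx w); first exact: smooth_dx.
by move=> s; rewrite derive1nS vw; apply/funext.
Qed.

Lemma smooth_is_derive1n tau v t n x : smooth_on tau v -> 0 < t -> (t%:E < tau)%E ->
  is_derive x 1 (derive1n n (v t)) (derive1n n.+1 (v t) x).
Proof.
move=> sv t0 ttau; have [w sw vw] := smooth_derive1n_dx n sv.
rewrite derive1nS vw; exact: smooth_is_derive_x sw t0 ttau.
Qed.

Lemma smooth_time_window tau t : 0 < t -> (t%:E < tau)%E ->
  exists2 r : R, 0 < r & forall s, `|s - t| <= r -> 0 < s /\ (s%:E < tau)%E.
Proof.
move=> t0 ttau.
have [r r0 tr] : exists2 r : R, 0 < r & ((t + r)%:E < tau)%E.
  case: tau ttau => [a| |]//; rewrite ?lte_fin => ta.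
    by exists ((a - t) / 2); rewrite ?lte_fin; [lra|lra].
  by exists 1 => //; rewrite ltry.
exists (Order.min r (t / 2)); first by rewrite lt_min r0/= divr_gt0.
move=> s; rewrite le_min => /andP[]; rewrite !ler_norml => /andP[_ sr] /andP[st _].
split; first by lra.
by apply: le_lt_trans tr; rewrite lee_fin; lra.
Qed.

(** The window around t times the cell is compact. *)
Lemma smooth_time_bounded tau v t : smooth_on tau v -> 0 < t -> (t%:E < tau)%E ->
  exists2 r : R, 0 < r & exists2 M : R, 0 <= M & forall s x, `|s - t| <= r ->
    0 <= x <= 2 * pi -> `|v s x| <= M.
Proof.
move=> sv t0 ttau; have [r r0 win] := smooth_time_window t0 ttau.
exists r => //.
pose K : set (R * R) := `[t - r, t + r]%classic `*` cell.
have inK s : t - r <= s <= t + r -> `|s - t| <= r.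
  by move=> /andP[sr sr']; rewrite ler_norml; apply/andP; split; lra.
have cK : {within K, continuous (fun z : R * R => v z.1 z.2)}.
  apply: continuous_in_subspaceT => -[s x]; rewrite inE /K => -[/= sI _].
  move: sI; rewrite in_itv/= => /inK /win[s0 stau].
  by have [c _] := sv 0%N; exact: c.
have compK : compact K by apply: compact_setX; exact: segment_compact.
have /compact_bounded[M [_ MK]] := continuous_compact cK compK.
exists (`|M| + 1); first by rewrite addr_ge0.
move=> s x sr x2; apply: MK.
  by rewrite (le_lt_trans (ler_norm M))// ltrDl.
exists (s, x) => //; split => /=; last by rewrite /cell/= in_itv.
by rewrite in_itv/=; move: sr; rewrite ler_norml => /andP[? ?]; apply/andP; split; lra.
Qed.

Lemma smooth_time_Lipschitz tau v t : smooth_on tau v -> 0 < t -> (t%:E < tau)%E ->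
  exists2 r : R, 0 < r & exists2 M : R, 0 <= M & forall h x, `|h| <= r ->
    0 <= x <= 2 * pi -> `|v (t + h) x - v t x| <= M * `|h|.
Proof.
move=> sv t0 ttau; have [r1 r10 win] := smooth_time_window t0 ttau.
have [r2 r20 [M M0 vM]] := smooth_time_bounded (smooth_dt sv) t0 ttau.
exists (Order.min r1 r2); first by rewrite lt_min r10.
exists M => // h x; rewrite le_min => /andP[h1 h2] x2.
have [s sh ->] : exists2 s, `|s - t| <= `|h| & v (t + h) x - v t x = dt v s x * h.
  apply: (increment_MVT (F := v ^~ x)) => s sh.
  have [s0 stau] := win s (le_trans sh h1).
  exact: smooth_is_derive_t sv s0 stau.
by rewrite normrM ler_wpM2r// vM// (le_trans sh).
Qed.

(** The mean value theorem writes the increment as h times the time derivative at an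
intermediate time, and this derivative is Lipschitz in time. *)
Lemma smooth_time_Taylor tau v t : smooth_on tau v -> 0 < t -> (t%:E < tau)%E ->
  exists2 r : R, 0 < r & exists2 M : R, 0 <= M & forall h x, `|h| <= r ->
    0 <= x <= 2 * pi -> `|v (t + h) x - v t x - h * dt v t x| <= M * h ^+ 2.
Proof.
move=> sv t0 ttau; have [r1 r10 win] := smooth_time_window t0 ttau.
have [r2 r20 [M M0 vM]] := smooth_time_Lipschitz (smooth_dt sv) t0 ttau.
exists (Order.min r1 r2); first by rewrite lt_min r10.
exists M => // h x; rewrite le_min => /andP[h1 h2] x2.
have [s sh ->] : exists2 s, `|s - t| <= `|h| & v (t + h) x - v t x = dt v s x * h.
  apply: (increment_MVT (F := v ^~ x)) => s sh.
  have [s0 stau] := win s (le_trans sh h1).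
  exact: smooth_is_derive_t sv s0 stau.
have -> : dt v s x * h - h * dt v t x = h * (dt v (t + (s - t)) x - dt v t x).
  by rewrite (_ : t + (s - t) = s); ring.
rewrite normrM -real_normK ?num_real// expr2 mulrCA ler_wpM2l//.
rewrite (le_trans (vM (s - t) x (le_trans sh h2) x2))// ler_wpM2l//.
Qed.

End SmoothInTime.

Section Approximation.
Context {R : realType}.
Implicit Types (phi : R -> R -> R) (T t x h : R).

(** The form of a multiple of f that weakH4_lin produces. *)
Lemma weakH4_scale c f (f4 : R -> R) : weakH4 f f4 ->
  weakH4 (fun x => (c - 1) * f x + f x) (fun x => (c - 1) * f4 x + f4 x).
Proof. by move=> Hf; exact: weakH4_lin. Qed.

(** The function C below is h times the error of the difference quotient, whose H^4
norm tends to 0; weakH4_sup controls C and its first derivative. *)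
Lemma approximation_increment T phi t : is_approximation T phi -> 0 < t < T ->
  Hper 4 (dt phi t) ->
  Hnorm 4 (fun x => (phi (t + h) x - phi t x) / h - dt phi t x)
    @[h --> 0^'] --> (0 : R) ->
  forall e : R, 0 < e -> \forall h \near 0^', 0 <= t + h <= T /\
    forall k, (k < 2)%N -> forall x, 0 <= x <= 2 * pi ->
    `|derive1n k (phi (t + h)) x - derive1n k (phi t) x
      - h * derive1n k (dt phi t) x| <= e * `|h|.
Proof.
move=> app /andP[t0 tT] Hr lim e e0.
have C0 := @H4_const_ge0 R.
have C1 : 0 < H4_const + 1 :> R by rewrite ltr_wpDl.
have near_e : \forall h \near (0:R)^',
    Hnorm 4 (fun x => (phi (t + h) x - phi t x) / h - dt phi t x) <= e / (H4_const + 1).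
  move/cvgrPdist_le : lim => /(_ _ (divr_gt0 e0 C1)).
  apply: filterS => h; rewrite sub0r normrN; exact/le_trans/ler_norm.
have near_T : \forall h \near (0:R)^', 0 <= t + h <= T.
  have r0 : 0 < Order.min t (T - t) by rewrite lt_min t0/= subr_gt0.
  near=> h; have : `|h| <= Order.min t (T - t) by near: h; exact: dnbhs0_le.
  by rewrite le_min !ler_norml => /andP[/andP[h1 h2] /andP[h3 h4]]; apply/andP; split; lra.
have near_0 : \forall h \near (0:R)^', h != 0 by exact: nbhs_dnbhs_neq.
move: near_e near_T near_0; apply: filterS3 => h he hT h0; split=> // k k2 x x2.
have Hp := Hper4_weakH4 (app_H4 app hT).
have Hpt : Hper 4 (phi t) by apply: (app_H4 app); rewrite !ltW.
have {}Hpt := Hper4_weakH4 Hpt; have {}Hr := Hper4_weakH4 Hr.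
pose B x := (- h) * dt phi t x + phi (t + h) x.
pose C x := -1 * phi t x + B x.
have HB := weakH4_lin (- h) Hr Hp.
have HC := weakH4_lin (-1) Hpt HB.
have HS := weakH4_scale h^-1 HC.
have k3 : (k < 3)%N by exact: leq_trans k2 _.
have eC : derive1n k C x = derive1n k (phi (t + h)) x - derive1n k (phi t) x
      - h * derive1n k (dt phi t) x.
  rewrite (derive1n_lin _ (weakH4_derivable Hpt) (weakH4_derivable HB) (ltnW k3)).
  rewrite (derive1n_lin _ (weakH4_derivable Hr) (weakH4_derivable Hp) (ltnW k3)).
  by ring.
have eS : (fun x => (phi (t + h) x - phi t x) / h - dt phi t x) =
    (fun x => (h^-1 - 1) * C x + C x).
  by apply/funext => y; rewrite /C /B; field.
have := weakH4_sup HS k2 x2.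
rewrite (derive1n_lin _ (weakH4_derivable HC) (weakH4_derivable HC) (ltnW k3)).
rewrite -eS -eC => hS.
have -> : derive1n k C x = h * ((h^-1 - 1) * derive1n k C x + derive1n k C x) by field.
rewrite normrM mulrC ler_wpM2r// (le_trans hS)//.
apply: (le_trans (ler_wpM2l C0 he)).
rewrite mulrCA -[leRHS]mulr1 (ler_wpM2l (ltW e0))//.
by rewrite ler_pdivrMr// mul1r lerDl.
Unshelve. all: by end_near. Qed.

End Approximation.

(** * The time derivative of the energy *)

Section EnergyDerivative.
Context {R : realType}.
Notation mu := (@lebesgue_measure R).

Lemma is_derive_of_increment (E : R -> R) (t l : R) :
  (forall e : R, 0 < e -> \forall h \near 0^', `|E (t + h) - E t - h * l| <= e * `|h|) ->
  is_derive t 1 E l.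
Proof.
move=> hE.
have lim : h^-1 *: ((E \o shift t) (h *: (1 : R)) - E t) @[h --> 0^'] --> l.
  apply/cvgrPdist_le => e e0.
  have near_0 : \forall h \near (0:R)^', h != 0 by exact: nbhs_dnbhs_neq.
  apply: filterS2 (hE e e0) near_0 => h he h0 /=.
  rewrite /GRing.scale/= mulr1.
  have -> : l - h^-1 * (E (h + t) - E t) = - (h^-1 * (E (t + h) - E t - h * l)).
    by rewrite (addrC h t); field.
  by rewrite normrN normrM normfV mulrC ler_pdivrMr// normr_gt0.
apply: DeriveDef; first by apply/cvg_ex; exists l.
exact: cvg_lim lim.
Qed.

(** Integration by parts moves the derivative of del onto d1, so only del itself, not
its space derivative, has to be compared with h q. In particular no mixed
derivative in t and x appears. *)
Lemma energy_increment (d1 d2 del del1 q : R -> R) (e M h : R) :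
  (forall x, 0 <= x <= 2 * pi -> is_derive x 1 d1 (d2 x)) ->
  (forall x, 0 <= x <= 2 * pi -> is_derive x 1 del (del1 x)) ->
  {within cell, continuous d2} -> {within cell, continuous del1} ->
  {within cell, continuous q} ->
  d1 (2 * pi) = d1 0 -> del (2 * pi) = del 0 -> 0 <= e -> 0 <= M ->
  (forall x, 0 <= x <= 2 * pi -> `|del x - h * q x| <= e * `|h|) ->
  (forall x, 0 <= x <= 2 * pi -> `|del1 x| <= M * `|h|) ->
  `|\int[mu]_(x in cell) (d1 x + del1 x) ^+ 2 - \int[mu]_(x in cell) d1 x ^+ 2
    - h * (- 2 * \int[mu]_(x in cell) (q x * d2 x))| <=
  2 * e * `|h| * (\int[mu]_(x in cell) `|d2 x|) + 2 * pi * (M * h) ^+ 2.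
Proof.
move=> dd1 ddel cd2 cdel1 cq d1e dele e0 M0 delq del1M.
have cd1 := segment_derive_continuous dd1.
have cdel := segment_derive_continuous ddel.
have ci (f : R -> R) : {within cell, continuous f} -> mu.-integrable cell (EFin \o f).
  exact: continuous_segment_integrable.
have parts := ac_prod (ac_C1 cd2 dd1) cdel1 ddel.
rewrite d1e dele subrr in parts.
have -> : \int[mu]_(x in cell) (d1 x + del1 x) ^+ 2 =
    \int[mu]_(x in cell) d1 x ^+ 2
    + (2 * \int[mu]_(x in cell) (d2 x * del x + d1 x * del1 x)
    - 2 * \int[mu]_(x in cell) (d2 x * (del x - h * q x))
    - 2 * h * \int[mu]_(x in cell) (q x * d2 x)
    + \int[mu]_(x in cell) del1 x ^+ 2).
  rewrite -!RintegralZl; try by [].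
  - rewrite -RintegralB// -?RintegralB// -?RintegralD//; try by apply: ci; within_cont.
    by apply: eq_Rintegral => x _; ring.
  - by apply: ci; within_cont.
  - by apply: ci; within_cont.
  - by apply: ci; within_cont.
rewrite parts mulr0 sub0r.
set I1 := \int[mu]_(x in cell) d1 x ^+ 2.
set I2 := \int[mu]_(x in cell) (d2 x * (del x - h * q x)).
set I3 := \int[mu]_(x in cell) (q x * d2 x).
set I4 := \int[mu]_(x in cell) del1 x ^+ 2.
have -> : I1 + (- (2 * I2) - 2 * h * I3 + I4) - I1 - h * (- 2 * I3) = I4 - 2 * I2 by ring.
have I4_ge0 : 0 <= I4 by apply: Rintegral_ge0 => x _; exact: sqr_ge0.
have I4_le : I4 <= 2 * pi * (M * h) ^+ 2.
  have := @segment_integral_le_cst R (fun x => del1 x ^+ 2) 0 (2 * pi) ((M * h) ^+ 2).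
  rewrite subr0 (mulrC (_ ^+ 2)); apply; [exact: pi2_ge0|by apply: ci; within_cont|].
  move=> x x2; rewrite -[leLHS]real_normK ?num_real// -[leRHS]real_normK ?num_real//.
  rewrite ler_pXn2r ?nnegrE// (le_trans (del1M x x2))// normrM ler_wpM2r//.
  exact: ler_norm.
have I2_le : `|I2| <= e * `|h| * \int[mu]_(x in cell) `|d2 x|.
  rewrite /I2 (le_trans (le_normr_Rintegral _ _))//; first by apply: ci; within_cont.
  rewrite -RintegralZl//; last by apply: ci; within_cont.
  apply: le_Rintegral => //; try by apply: ci; within_cont.
  move=> x; rewrite /cell/= in_itv/= => x2.
  by rewrite normrM mulrC ler_wpM2r// delq.
rewrite (le_trans (ler_normB _ _))// addrC lerD//.
  by rewrite normrM ger0_norm// -!mulrA ler_wpM2l// mulrA.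
by rewrite ger0_norm.
Qed.

End EnergyDerivative.

Section ErrorEnergy.
Context {R : realType}.
Notation mu := (@lebesgue_measure R).
Context (tau : \bar R) (T : R) (u phi : R -> R -> R).
Context (hu : is_solution tau u) (hphi : is_approximation T phi).
Implicit Types (t x : R) (n : nat).

Let d (t x : R) : R := u t x - phi t x.

Let sol_der t n x : 0 < t -> (t%:E < tau)%E ->
  is_derive x 1 (derive1n n (u t)) (derive1n n.+1 (u t) x).
Proof. exact: smooth_is_derive1n (sol_smooth hu). Qed.

Let app_der t n x : 0 <= t <= T -> (n < 3)%N ->
  is_derive x 1 (derive1n n (phi t)) (derive1n n.+1 (phi t) x).
Proof.
by move=> ht n3; apply: derive1n_is_derive; exact: (Hper_derivable (app_H4 hphi ht)).
Qed.

Lemma error_derive1n t n : 0 < t -> (t%:E < tau)%E -> 0 <= t <= T -> (n <= 3)%N ->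
  derive1n n (d t) = fun x => derive1n n (u t) x - derive1n n (phi t) x.
Proof.
move=> t0 ttau tT n3.
have -> : d t = fun x => -1 * phi t x + u t x.
  by apply/funext => x; rewrite /d; ring.
rewrite (@derive1n_lin R (-1) (phi t) (u t) 3)//.
- by apply/funext => x; ring.
- by move=> k k3 x; have [] := app_der x tT k3.
- by move=> k k3 x; have [] := sol_der k x t0 ttau.
Qed.

Lemma error_is_derive t n x : 0 < t -> (t%:E < tau)%E -> 0 <= t <= T -> (n < 3)%N ->
  is_derive x 1 (derive1n n (d t)) (derive1n n.+1 (d t) x).
Proof.
move=> t0 ttau tT n3; rewrite !error_derive1n//; last exact: ltnW.
exact: is_derive_subr (sol_der n x t0 ttau) (app_der x tT n3).
Qed.

Lemma error_periodic t x : 0 < t -> (t%:E < tau)%E -> 0 <= t <= T ->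
  d t (x + 2 * pi) = d t x.
Proof.
move=> t0 ttau tT; rewrite /d (Hper_periodic (sol_H1 hu (ltW t0) ttau)).
by rewrite (Hper_periodic (app_H4 hphi tT)).
Qed.

(** The increments of u are controlled by smooth_time_Taylor, those of its space
derivative by smooth_time_Lipschitz, and those of phi by
approximation_increment. *)
Lemma error_energy_is_derive t : 0 < t < T -> (t%:E < tau)%E ->
  Hper 4 (dt phi t) ->
  Hnorm 4 (fun x => (phi (t + h) x - phi t x) / h - dt phi t x)
    @[h --> 0^'] --> (0 : R) ->
  is_derive t 1 (fun s => Hnorm 1 (d s) ^+ 2)
    (- 2 * \int[mu]_(x in cell) ((dt u t x - dt phi t x) * derive1n 2 (d t) x)).
Proof.
move=> /andP[t0 tT] ttau Hr lim.
have su := sol_smooth hu.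
have tT' : 0 <= t <= T by rewrite !ltW.
have cder (f f' : R -> R) : (forall x : R, is_derive x 1 f (f' x)) ->
    {within cell, continuous f}.
  by move=> df; apply: (segment_derive_continuous (f' := f')) => x _.
have c1 : {within cell, continuous (derive1n 1 (d t))}.
  by apply: cder => x; exact: error_is_derive.
have c2 : {within cell, continuous (derive1n 2 (d t))}.
  by apply: cder => x; exact: error_is_derive.
have rder n x : (n < 3)%N ->
    is_derive x 1 (derive1n n (dt phi t)) (derive1n n.+1 (dt phi t) x).
  by move=> n3; apply: derive1n_is_derive; exact: (Hper_derivable Hr).
have cut : {within cell, continuous (dt u t)}.
  by apply: cder => x; exact: smooth_is_derive_x (smooth_dt su) t0 ttau.
have cr0 : {within cell, continuous (dt phi t)}.
  by apply: cder => x; exact: (rder 0%N).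
have cr1 : {within cell, continuous (derive1n 1 (dt phi t))}.
  by apply: cder => x; exact: rder.
have cq : {within cell, continuous (fun x => dt u t x - dt phi t x)}.
  exact: within_continuousB.
apply: is_derive_of_increment => e e0.
pose A := \int[mu]_(x in cell) `|derive1n 2 (d t) x|.
have A0 : 0 <= A by exact: Rintegral_ge0.
(* Half of e pays for the first-order error, half for the quadratic one. *)
pose e1 := Order.min 1 (e / (8 * (A + 1))).
have e10 : 0 < e1 by rewrite lt_min ltr01/= divr_gt0// mulr_gt0// ltr_wpDl.
have e1_le1 : e1 <= 1 by rewrite ge_min lexx.
have e1A : 4 * e1 * A <= e / 2.
  have h : e1 * (8 * (A + 1)) <= e.
    by rewrite -ler_pdivlMr ?mulr_gt0// ?ltr_wpDl// ge_min lexx orbT.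
  have := mulr_ge0 (ltW e10) A0; lra.
have [r1 r10 [M1 M10 tay]] := smooth_time_Taylor su t0 ttau.
have [r2 r20 [M2 M20 lip]] := smooth_time_Lipschitz (smooth_dx su) t0 ttau.
have [r3 r30 win] := smooth_time_window t0 ttau.
have [B B0 rB] := continuous_segment_bounded cr1.
pose M := M2 + 1 + B.
have M0 : 0 <= M by rewrite !addr_ge0.
pose r4 := e1 / (M1 + 1).
have r40 : 0 < r4 by rewrite divr_gt0// ltr_wpDl.
pose C := 2 * pi * M ^+ 2 : R.
have C0 : 0 <= C by rewrite mulr_ge0 ?pi2_ge0 ?exprn_ge0.
pose r5 := e / (2 * (C + 1)).
have r50 : 0 < r5 by rewrite divr_gt0// mulr_gt0// ltr_wpDl.
near=> h.
have hr1 : `|h| <= r1 by near: h; exact: dnbhs0_le.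
have hr2 : `|h| <= r2 by near: h; exact: dnbhs0_le.
have hr3 : `|h| <= r3 by near: h; exact: dnbhs0_le.
have hr4 : `|h| <= r4 by near: h; exact: dnbhs0_le.
have hr5 : `|h| <= r5 by near: h; exact: dnbhs0_le.
have [hT papp] : 0 <= t + h <= T /\
    forall k, (k < 2)%N -> forall x, 0 <= x <= 2 * pi ->
    `|derive1n k (phi (t + h)) x - derive1n k (phi t) x
      - h * derive1n k (dt phi t) x| <= e1 * `|h|.
  by near: h; apply: (approximation_increment hphi _ Hr lim e10); rewrite t0.
have [th0 thtau] : 0 < t + h /\ ((t + h)%:E < tau)%E.
  by apply: win; rewrite addrC addKr.
pose del x : R := d (t + h) x - d t x.
pose del1 x : R := derive1n 1 (d (t + h)) x - derive1n 1 (d t) x.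
have ddel x : is_derive x 1 del (del1 x).
  apply: is_derive_subr; first exact: (error_is_derive (n := 0)).
  exact: (error_is_derive (n := 0)).
have c1h : {within cell, continuous (derive1n 1 (d (t + h)))}.
  by apply: cder => x; exact: error_is_derive.
have cdel1 : {within cell, continuous del1} by exact: within_continuousB.
have delq x : 0 <= x <= 2 * pi ->
    `|del x - h * (dt u t x - dt phi t x)| <= 2 * e1 * `|h|.
  move=> x2.
  have -> : del x - h * (dt u t x - dt phi t x) =
      (u (t + h) x - u t x - h * dt u t x)
      - (phi (t + h) x - phi t x - h * dt phi t x) by rewrite /del /d; ring.
  rewrite (le_trans (ler_normB _ _))//.
  have h1 := tay h x hr1 x2; have h2 := papp 0%N isT x x2.
  have h3 : M1 * h ^+ 2 <= e1 * `|h|.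
    rewrite -real_normK ?num_real// expr2 mulrA ler_wpM2r//.
    rewrite (le_trans (ler_wpM2l M10 hr4))// /r4 mulrA ler_pdivrMr ?ltr_wpDl//.
    by rewrite mulrC ler_wpM2l ?ltW// ltrDl.
  have -> : 2 * e1 * `|h| = e1 * `|h| + e1 * `|h| by ring.
  by rewrite lerD// (le_trans h1).
have del1M x : 0 <= x <= 2 * pi -> `|del1 x| <= M * `|h|.
  move=> x2.
  have -> : del1 x = (dx u (t + h) x - dx u t x)
      - ((derive1n 1 (phi (t + h)) x - derive1n 1 (phi t) x
          - h * derive1n 1 (dt phi t) x) + h * derive1n 1 (dt phi t) x).
    rewrite /del1 !error_derive1n// /dx /=; ring.
  have -> : M * `|h| = M2 * `|h| + (1 * `|h| + B * `|h|) by rewrite /M; ring.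
  rewrite (le_trans (ler_normB _ _))// lerD ?lip//.
  rewrite (le_trans (ler_normD _ _))// lerD//.
    by apply: le_trans (papp 1%N isT x x2) _; rewrite ler_wpM2r.
  by rewrite normrM mulrC ler_wpM2r// rB.
have d1e : derive1n 1 (d t) (2 * pi) = derive1n 1 (d t) 0.
  by apply: periodic_at0 => x; exact: error_periodic.
have dele : del (2 * pi) = del 0.
  rewrite /del -[in LHS](add0r (2 * pi)).
  by rewrite !error_periodic.
have e12 : 0 <= 2 * e1 by rewrite mulr_ge0// ltW.
have dd1 x : 0 <= x <= 2 * pi ->
    is_derive x 1 (derive1n 1 (d t)) (derive1n 2 (d t) x).
  by move=> _; exact: error_is_derive.
have := energy_increment dd1 (fun x _ => ddel x) c2 cdel1 cq d1e dele e12 M0 delq del1M.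
rewrite !Lqnorm2_sqr.
have -> : \int[mu]_(x in cell) (derive1n 1 (d t) x + del1 x) ^+ 2 =
    \int[mu]_(x in cell) derive1n 1 (d (t + h)) x ^+ 2.
  by apply: eq_Rintegral => x _; rewrite /del1 addrC subrK.
move=> /le_trans; apply.
rewrite -/A.
have -> : 2 * (2 * e1) * `|h| * A = 4 * e1 * A * `|h| by ring.
have -> : 2 * pi * (M * h) ^+ 2 = C * `|h| * `|h|.
  rewrite exprMn -[h ^+ 2]real_normK ?num_real// /C; ring.
have Ch : C * `|h| <= e / 2.
  have C1 : 0 < C + 1 by rewrite ltr_wpDl.
  have e2 : 0 <= e / 2 by rewrite divr_ge0// ltW.
  apply: (le_trans (ler_wpM2l C0 hr5)).
  have -> : C * r5 = e / 2 * (C / (C + 1)) by rewrite /r5; field; rewrite gt_eqF.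
  rewrite -[leRHS]mulr1 (ler_wpM2l e2)// ler_pdivrMr// mul1r lerDl//.
rewrite -mulrDl ler_wpM2r//; lra.
Unshelve. all: by end_near. Qed.

End ErrorEnergy.

(** * The differential inequality *)

Section StaticAtTime.
Context {R : realType}.
Notation mu := (@lebesgue_measure R).

Lemma derive1n2_sqr (f f1 f2 : R -> R) : (forall x : R, is_derive x 1 f (f1 x)) ->
  (forall x : R, is_derive x 1 f1 (f2 x)) ->
  derive1n 2 (fun y => f y ^+ 2) = fun x => 2 * f1 x ^+ 2 + 2 * f x * f2 x.
Proof.
move=> df df1.
have e1 : derive1 (fun y => f y ^+ 2) = fun x => 2 * (f x * f1 x).
  apply/funext => x; have dfx := df x; rewrite derive1E.
  have h : is_derive x 1 (fun y => f y ^+ 2) (2 * (f x * f1 x)).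
    by apply: is_derive_val; rewrite /GRing.scale/= ?expr1; ring.
  by rewrite derive_val.
rewrite derive1nS derive1n1 e1; apply/funext => x; rewrite derive1E.
have dfx := df x; have df1x := df1 x.
have h : is_derive x 1 (fun y => 2 * (f y * f1 y)) (2 * f1 x ^+ 2 + 2 * f x * f2 x).
  by apply: is_derive_val; rewrite /GRing.scale/=; ring.
by rewrite derive_val.
Qed.

Lemma within_continuous_sqr_second (f f1 f2 : R -> R) : {within cell, continuous f} ->
  {within cell, continuous f1} -> {within cell, continuous f2} ->
  {within cell, continuous (fun x => 2 * f1 x ^+ 2 + 2 * f x * f2 x)}.
Proof. by move=> cf cf1 cf2; within_cont. Qed.

(** By the equation, u_t - phi_t is minus the sum of the linear and nonlinear terms
of the error and of the residual, which is the integrand of energy_estimate. *)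
Lemma residual_estimate (tau : \bar R) (T : R) (u phi : R -> R -> R) (t : R) :
  is_solution tau u -> is_approximation T phi ->
  0 < t < T -> (t%:E < tau)%E -> Hper 4 (dt phi t) ->
  let d := fun t x => u t x - phi t x in
  - (\int[mu]_(x in cell) ((dt u t x - dt phi t x) * derive1n 2 (d t) x)) <=
    - (4^-1 * Hnorm 3 (d t) ^+ 2) + 7 ^+ 7 / 4 * Hnorm 1 (d t) ^+ 10
    + Hm1norm (Res phi t) ^+ 2
    + 9 * Hnorm 1 (d t) ^+ 2 * Lqnorm +oo%E (derive1n 2 (phi t)) ^+ 2 /\
  Hnorm 1 (d t) ^+ 2 <= Hnorm 3 (d t) ^+ 2.
Proof.
move=> hu hphi /andP[t0 tT] ttau Hr d.
have su := sol_smooth hu.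
have tT' : 0 <= t <= T by rewrite !ltW.
have HP := app_H4 hphi tT'.
have dU n (x : R) : is_derive x 1 (derive1n n (u t)) (derive1n n.+1 (u t) x).
  exact: smooth_is_derive1n su t0 ttau.
have dP n (x : R) : (n < 3)%N ->
    is_derive x 1 (derive1n n (phi t)) (derive1n n.+1 (phi t) x).
  by move=> n3; apply: derive1n_is_derive; exact: (Hper_derivable HP).
have dd n (x : R) : (n < 3)%N ->
    is_derive x 1 (derive1n n (d t)) (derive1n n.+1 (d t) x).
  by move=> n3; exact: (error_is_derive hu hphi x t0 ttau tT' n3).
have dE n : (n <= 3)%N ->
    derive1n n (d t) = fun x => derive1n n (u t) x - derive1n n (phi t) x.
  by move=> n3; exact: (error_derive1n hu hphi t0 ttau tT' n3).
have dper x : d t (x + 2 * pi) = d t x by exact: (error_periodic hu hphi x t0 ttau tT').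
have acP := Hper_ac HP.
have cP3 := ac_continuous acP.
have conU n : continuous (derive1n n (u t)).
  by apply: derivable_continuous => x; have [] := dU n x.
have cP3' : continuous (derive1n 3 (phi t)).
  apply: (periodic_continuous _ cP3); apply: derive1n_periodic.
  exact: (Hper_periodic HP).
have cd3' : continuous (derive1n 3 (d t)).
  by rewrite (dE 3%N isT) => x; apply: cvgB; [exact: conU|exact: cP3'].
have cd n : (n <= 3)%N -> {within cell, continuous (derive1n n (d t))}.
  rewrite leq_eqVlt => /orP[/eqP ->|n3]; first exact: continuous_subspaceT.
  by apply/continuous_subspaceT/derivable_continuous => x; have [] := dd n x n3.
have cP n : (n < 3)%N -> {within cell, continuous (derive1n n (phi t))}.
  move=> n3.
  by apply/continuous_subspaceT/derivable_continuous => x; have [] := dP n x n3.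
pose D4 x := -1 * derive1n 4 (phi t) x + derive1n 4 (u t) x.
have acd3 : ac (derive1n 3 (d t)) D4.
  have -> : derive1n 3 (d t) = fun x => -1 * derive1n 3 (phi t) x + derive1n 3 (u t) x.
    by rewrite (dE 3%N isT); apply/funext => x; rewrite mulN1r addrC.
  have acU : ac (derive1n 3 (u t)) (derive1n 4 (u t)).
    have c4 : {within cell, continuous (derive1n 4 (u t))}.
      exact/continuous_subspaceT/conU.
    exact: ac_C1 c4 (fun x _ => dU 3%N x).
  exact: (ac_lin (-1) acP acU).
pose F1 := derive1n 1 (phi t); pose F2 := derive1n 2 (phi t).
pose F3 := derive1n 3 (phi t).
have ResE : Res phi t = fun x => dt phi t x +
    (derive1n 4 (phi t) x + (2 * F2 x ^+ 2 + 2 * F1 x * F3 x)).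
  apply/funext => x; rewrite /Res /growth_op; congr (_ + (_ + _)).
  have sq := derive1n2_sqr (fun x => dP 1%N x isT) (fun x => dP 2%N x isT).
  exact: (congr1 (fun g : R -> R => g x) sq).
have cr : {within cell, continuous (dt phi t)}.
  apply/continuous_subspaceT/derivable_continuous.
  exact: (Hper_derivable Hr (k := 0)).
have iRes : mu.-integrable cell (EFin \o Res phi t).
  have ir := continuous_segment_integrable cr.
  have iF : mu.-integrable cell (EFin \o (fun x => 2 * F2 x ^+ 2 + 2 * F1 x * F3 x)).
    apply: continuous_segment_integrable.
    exact: within_continuous_sqr_second (cP 1%N isT) (cP 2%N isT) cP3.
  rewrite ResE; apply: (integrable_add measurable_cell ir).
  exact: (integrable_add measurable_cell (proj1 acP) iF).
have dper_n n : derive1n n (d t) (2 * pi) = derive1n n (d t) 0 by exact: (periodic_at0 n dper).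
have mean n : (n < 3)%N -> \int[mu]_(x in cell) derive1n n.+1 (d t) x = 0.
  move=> n3; rewrite (_ : Rintegral _ _ _ =
      derive1n n (d t) (2 * pi) - derive1n n (d t) 0); first by rewrite dper_n subrr.
  exact: segment_FTC pi2_ge0 (cd n.+1 n3) (fun x _ => dd n x n3).
have a0 : 0 <= Hnorm 1 (d t) by exact: Lqnorm_ge0.
have b0 : 0 <= Hnorm 3 (d t) by exact: Lqnorm_ge0.
have N0 : 0 <= Lqnorm +oo%E F2 by exact: Lqnorm_ge0.
have aE := esym (Lqnorm2_sqr (derive1n 1 (d t))).
have bE := esym (Lqnorm2_sqr (derive1n 3 (d t))).
split; last first.
  rewrite !Lqnorm2_sqr; apply: (@le_trans _ _ (\int[mu]_(x in cell) derive1n 2 (d t) x ^+ 2)).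
    exact: Wirtinger (fun x _ => dd 1%N x isT) (cd 2%N isT) (dper_n 1%N) (mean 0%N isT).
  exact: Wirtinger (fun x _ => dd 2%N x isT) (cd 3%N isT) (dper_n 2%N) (mean 1%N isT).
have pairing := Hm1norm_pairing iRes (derive1n_periodic 2 dper) (mean 1%N isT)
  (fun x => dd 2%N x isT) cd3' b0 bE.
have PN : \forall x \ae mu, cell x -> `|F2 x| <= Lqnorm +oo%E F2.
  exact: (continuous_le_Lqnormy (cP 2%N isT)).
have := @energy_estimate R (derive1n 1 (d t)) (derive1n 2 (d t)) (derive1n 3 (d t))
  D4 F1 F2 F3 (Res phi t) _ _ _ _
  (fun x _ => dd 1%N x isT) (fun x _ => dd 2%N x isT)
  (fun x _ => dP 1%N x isT) (fun x _ => dP 2%N x isT) acd3 cP3 iRes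
  (dper_n 1%N) (dper_n 2%N) (dper_n 3%N)
  (periodic_at0 1 (Hper_periodic HP)) (periodic_at0 2 (Hper_periodic HP))
  a0 b0 N0 aE bE PN pairing.
congr (_ <= _).
have iq : mu.-integrable cell (EFin \o
    (fun x => (dt u t x - dt phi t x) * derive1n 2 (d t) x)).
  have cu : {within cell, continuous (dt u t)}.
    apply/continuous_subspaceT/derivable_continuous => x.
    by have [] := smooth_is_derive_x x (smooth_dt su) t0 ttau.
  apply: continuous_segment_integrable.
  exact: within_continuousM (within_continuousB cu cr) (cd 2%N isT).
rewrite -mulN1r -RintegralZl//; apply: eq_Rintegral => x _.
rewrite (sol_eq hu x t0 ttau) /growth_op ResE.
have sq := derive1n2_sqr (dU 1%N) (dU 2%N).
have -> : derive1n 2 (fun y => dx u t y ^+ 2) x = 2 * derive1n 2 (u t) x ^+ 2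
    + 2 * derive1n 1 (u t) x * derive1n 3 (u t) x.
  exact: (congr1 (fun g : R -> R => g x) sq).
rewrite (dE 1%N isT) (dE 2%N isT) (dE 3%N isT) /D4 -/F1 -/F2 -/F3.
move: (derive1n 1 (u t) x) (derive1n 2 (u t) x) (derive1n 3 (u t) x)
  (derive1n 4 (u t) x) (F1 x) (F2 x) (F3 x) (derive1n 4 (phi t) x) (dt phi t x).
by clear; move=> *; ring.
Qed.

Lemma dissipation_weaken (a2 b2 k m n : R) : a2 <= b2 ->
  - (4^-1 * b2) + k + m + 9 * a2 * n <= k + (9 * n - 4^-1) * a2 + m.
Proof.
move=> ab; have -> : (9 * n - 4^-1) * a2 = 9 * a2 * n - 4^-1 * a2 by ring.
by move: (9 * a2 * n) => y; lra.
Qed.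

End StaticAtTime.

Unset Implicit Arguments.

Theorem mainTheorem1 (R : realType) (tau : \bar R) (T : R) (u phi : R -> R -> R)
    (hu : is_maximal_solution tau u) (hT : 0 < T) (hphi : is_approximation T phi) :
  let d : R -> R -> R := fun t x => u t x - phi t x in
  let K : R := 7 ^+ 7 / 4 in
  let E : R -> R := fun t => Hnorm 1 (d t) ^+ 2 in
  \forall t \ae lebesgue_measure, 0 < t < T -> (t%:E < tau)%E ->
    [/\ derivable E t 1,
        2^-1 * derive1 E t <=
          - (4^-1 * Hnorm 3 (d t) ^+ 2) + K * Hnorm 1 (d t) ^+ 10
          + Hm1norm (Res phi t) ^+ 2
          + 9 * Hnorm 1 (d t) ^+ 2 * Lqnorm +oo%E (derive1n 2 (phi t)) ^+ 2 &
        2^-1 * derive1 E t <=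
          K * Hnorm 1 (d t) ^+ 10
          + (9 * Lqnorm +oo%E (derive1n 2 (phi t)) ^+ 2 - 4^-1) * Hnorm 1 (d t) ^+ 2
          + Hm1norm (Res phi t) ^+ 2].
Proof.
move=> d K E.
have [hsol _] := hu.
move: (app_dt hphi); apply: filterS; first exact: (ae_filter_ringOfSetsType lebesgue_measure).
move=> t app t0T ttau; have [Hr lim] := app t0T.
have dEt := error_energy_is_derive hsol hphi t0T ttau Hr lim.
have [est le13] := residual_estimate hsol hphi t0T ttau Hr.
have E'E : 2^-1 * derive1 E t =
    - (\int[lebesgue_measure]_(x in cell) ((dt u t x - dt phi t x) * derive1n 2 (d t) x)).
  by rewrite derive1E (@derive_val _ _ _ _ _ _ _ dEt) mulrA mulrN mulVf ?mulN1r// pnatr_eq0.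
split.
- by have [] := dEt.
- by rewrite E'E.
- by rewrite E'E; exact: le_trans est (dissipation_weaken _ _ _ le13).
Qed.
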